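(* The dimension $D$ of the vector space of invariant linear connections on a Poincaré superspacetime of signature $(r,s)$ depends on $r-s \bmod 8$ as follows: $$\begin{array}{c|cccccccc} r-s \bmod 8 & 1&2&3&4&5&6&7&8\\ \hline D & 12&24&12&24&12&6&3&6\end{array}$$
   Context: Let $\mathbb{R}^{r,s}$ be $\mathbb{R}^{r+s}$ with the standard inner product $\langle\cdot,\cdot\rangle$ of signature $(r,s)$ ($r$ plus signs, $s$ minus signs), $\mathrm{Cl}_{r,s}$ its Clifford algebra with convention $v\cdot v=-\langle v,v\rangle$, and $\mathrm{Spin}^0_{r,s}\subseteq\mathrm{Cl}_{r,s}$ the connected spin group with Lie algebra $\mathfrak{spin}_{r,s}$. $\mathrm{Spin}^0_{r,s}$ acts on $\mathbb{R}^{r,s}$ by the vector representation $v\mapsto g\cdot v\cdot g^{-1}$. Let $S$ be an irreducible real $\mathrm{Cl}_{r,s}$-module, regarded as a representation of $\mathrm{Spin}^0_{r,s}$ by restriction (the real spin representation, possibly reducible). Given a $\mathfrak{spin}_{r,s}$-invariant symmetric bilinear map $\Gamma:S\vee S\to\mathbb{R}^{r,s}$, the Poincaré Lie superalgebra is $\mathfrak{g}=\mathfrak{g}_{\bar0}+\mathfrak{g}_{\bar1}=(\mathfrak{spin}_{r,s}\ltimes\mathbb{R}^{r,s})+S$ with $[A,s]=A\cdot s$ (spin representation), $[\mathbb{R}^{r,s},S]=0$ and $[\cdot,\cdot]|_{S\vee S}=\Gamma$. The Poincaré Lie supergroup $G$ is the Lie supergroup of the super Harish-Chandra pair $(\mathrm{Spin}^0_{r,s}\ltimes\mathbb{R}^{r,s},\mathfrak{g})$.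 The Poincaré superspacetime is the homogeneous supermanifold $M=G/H_0$, $H_0=\mathrm{Spin}^0_{r,s}$, with reductive decomposition $\mathfrak{g}=\mathfrak{h}+\mathfrak{m}$, $\mathfrak{h}=\mathfrak{spin}_{r,s}$, $\mathfrak{m}=\mathbb{R}^{r,s}+S$ (even part $\mathbb{R}^{r,s}$, odd part $S$). The set of $G$-invariant linear connections on $M$ is identified (by the Nomizu map correspondence for reductive homogeneous supermanifolds) with the vector space of even linear $\mathrm{Spin}^0_{r,s}$-equivariant maps $L:\mathbb{R}^{r,s}+S\to\mathfrak{gl}_{\mathbb{R}}(\mathbb{R}^{r,s}+S)$, and its vector space structure and dimension are understood through this identification. ''Even'' means that $\mathbb{R}^{r,s}$ is mapped to grading-preserving endomorphisms and $S$ to grading-reversing ones.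
   Formalization: The signatures with r+s = 0, 1 or 3 are excluded because the table fails for all of them: for r+s = 1 or 3 an extra invariant map from R^{r,s} to gl(R^{r,s}) makes D one larger (13 instead of 12 for (3,0)), and for r+s = 0 one has D = 0. *)

(* Defs.v *)
From HB Require Import structures.
From mathcomp Require Import all_boot all_order all_algebra all_field.
From mathcomp Require Import all_classical all_reals all_analysis.

Set Implicit Arguments.
Unset Strict Implicit.
Unset Printing Implicit Defensive.

Import Order.TTheory GRing.Theory Num.Theory.
Import numFieldNormedType.Exports.

Local Open Scope classical_set_scope.
Local Open Scope ring_scope.

(* The first r basis vectors have square 1, the last s have square -1. *)
Definition sprod (R : realType) (r s : nat) (v w : 'rV[R]_(r + s)) : R :=
  \sum_(i < r + s) (if (i < r)%N then 1 else -1) * v 0 i * w 0 i.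

Definition is_clifford_map (R : realType) (r s : nat) (A : algType R)
    (f : 'rV[R]_(r + s) -> A) : Prop :=
  linear f /\ forall v, f v * f v = - (sprod v v)%:A.

(* The Clifford algebra is specified by its universal property. It is
   nonzero and finite dimensional, so its carrier may be taken in falgType. *)
Definition is_clifford_algebra (R : realType) (r s : nat) (C : falgType R)
    (iota : 'Hom('rV[R]_(r + s), C)) : Prop :=
  is_clifford_map iota /\
  forall (A : algType R) (f : 'rV[R]_(r + s) -> A), is_clifford_map f ->
    exists F : {lrmorphism C -> A},
      (forall v, F (iota v) = f v) /\
      forall G : {lrmorphism C -> A}, (forall v, G (iota v) = f v) -> G =1 F.

Definition spin_group (R : realType) (r s : nat) (C : falgType R)
    (iota : 'Hom('rV[R]_(r + s), C)) : set C :=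
  [set g | exists vs : seq 'rV[R]_(r + s),
     [/\ ~~ odd (size vs),
         (forall v, v \in vs -> sprod v v = 1 \/ sprod v v = -1)
       & g = \prod_(v <- vs) iota v]].

(* Linear coordinates, used to give C its topology as a finite-dimensional
   real vector space; that topology does not depend on the basis. *)
Definition coords (R : realType) (C : falgType R) (x : C) :
    'rV[R]_(\dim {:C}) :=
  \row_i coord (vbasis {:C}) i x.

(* Identity component of the spin group. For r = s = 1 it is a proper subgroup
   of the group of products of evenly many positive and evenly many negative
   unit vectors, which contains -1. *)
Definition spin0 (R : realType) (r s : nat) (C : falgType R)
    (iota : 'Hom('rV[R]_(r + s), C)) : set C :=
  [set g | spin_group iota g /\
     connected_component (@coords R C @` spin_group iota) (coords 1)
       (coords g)].

Definition spin_lie (R : realType) (r s : nat) (C : falgType R)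
    (iota : 'Hom('rV[R]_(r + s), C)) : {vspace C} :=
  (\sum_(i < r + s) \sum_(j < r + s | (i < j)%N)
     <[(iota (delta_mx 0 i) * iota (delta_mx 0 j))%R]>)%VS.

(* iota is injective, with left inverse iota^-1; for g in the spin group
   g * iota v * g^-1 lies in the image of iota. *)
Definition vector_rep (R : realType) (r s : nat) (C : falgType R)
    (iota : 'Hom('rV[R]_(r + s), C)) (g : C) (v : 'rV[R]_(r + s)) :
    'rV[R]_(r + s) :=
  (iota^-1)%VF (g * iota v * g^-1).

Definition vector_rep_lie (R : realType) (r s : nat) (C : falgType R)
    (iota : 'Hom('rV[R]_(r + s), C)) (a : C) (v : 'rV[R]_(r + s)) :
    'rV[R]_(r + s) :=
  (iota^-1)%VF (a * iota v - iota v * a).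

Definition is_module (R : realType) (C : falgType R) (S : vectType R)
    (rho : 'Hom(C, 'End(S))) : Prop :=
  rho 1 = \1%VF /\ forall a b, rho (a * b) = (rho a \o rho b)%VF.

(* Irreducible modules over a finite-dimensional algebra are finite
   dimensional, so vectType is no restriction on S. *)
Definition is_irreducible_module (R : realType) (C : falgType R)
    (S : vectType R) (rho : 'Hom(C, 'End(S))) : Prop :=
  [/\ is_module rho,
      ({:S} != 0)%VS
    & forall U : {vspace S}, (forall a, (rho a @: U <= U)%VS) ->
        U = 0%VS \/ U = {:S}%VS].

(* The odd bracket S x S -> R^{r,s} of a Poincare Lie superalgebra. *)
Definition is_poincare_bracket (R : realType) (r s : nat) (C : falgType R)
    (iota : 'Hom('rV[R]_(r + s), C)) (S : vectType R)
    (rho : 'Hom(C, 'End(S))) (Gamma : S -> S -> 'rV[R]_(r + s)) : Prop :=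
  [/\ forall x, linear (Gamma x),
      forall x y, Gamma x y = Gamma y x
    & forall a x y, a \in spin_lie iota ->
        Gamma (rho a x) y + Gamma x (rho a y) =
        vector_rep_lie iota a (Gamma x y)].

(* The action on m = R^{r,s} + S, with even part R^{r,s} and odd part S. *)
Definition isotropy_rep (R : realType) (r s : nat) (C : falgType R)
    (iota : 'Hom('rV[R]_(r + s), C)) (S : vectType R)
    (rho : 'Hom(C, 'End(S))) (g : C) (x : 'rV[R]_(r + s) * S) :
    'rV[R]_(r + s) * S :=
  (vector_rep iota g x.1, rho g x.2).

Definition even_end (R : realType) (V S : vectType R)
    (A : 'End((V * S)%type)) : Prop :=
  (forall v, (A (v, 0)).2 = 0) /\ (forall x, (A (0, x)).1 = 0).

Definition odd_end (R : realType) (V S : vectType R)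
    (A : 'End((V * S)%type)) : Prop :=
  (forall v, (A (v, 0)).1 = 0) /\ (forall x, (A (0, x)).2 = 0).

(* Nomizu maps, i.e. invariant linear connections on the superspacetime;
   equivariance is for the conjugation action of the group on gl(m). *)
Definition nomizu_maps (R : realType) (r s : nat) (C : falgType R)
    (iota : 'Hom('rV[R]_(r + s), C)) (S : vectType R)
    (rho : 'Hom(C, 'End(S))) :
    set 'Hom(('rV[R]_(r + s) * S)%type, 'End(('rV[R]_(r + s) * S)%type)) :=
  [set L | [/\ forall v, even_end (L (v, 0)),
               forall x, odd_end (L (0, x))
             & forall g, spin0 iota g -> forall x y,
                 L (isotropy_rep iota rho g x) y =
                 isotropy_rep iota rho g
                   (L x (isotropy_rep iota rho g^-1 y))]].

Definition has_dim (R : realType) (W : vectType R) (P : set W) (d : nat) :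
    Prop :=
  exists U : {vspace W}, (forall x, x \in U <-> P x) /\ \dim U = d.

(* Indexed by residues 0, ..., 7; residue 0 is the column 8. *)
Definition connection_dim (k : int) : nat :=
  nth 0%N [:: 6; 12; 24; 12; 24; 12; 6; 3]%N `|(k %% 8)%Z|%N.

(* Main.v *)
Require Import Defs.
From HB Require Import structures.
From mathcomp Require Import all_boot all_order all_algebra all_field.
From mathcomp Require Import all_classical all_reals all_analysis.
From mathcomp Require Import complex.
From mathcomp Require Import ring lra zify.

Set Implicit Arguments.
Unset Strict Implicit.
Unset Printing Implicit Defensive.

Import Order.TTheory GRing.Theory Num.Theory.
Import VectorInternalTheory numFieldNormedType.Exports.

Local Open Scope ring_scope.

(** Write [n = r + s], [V = R^{r,s}], [e_i] for the standard basis of [V] and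
    [g_i] for the action of [e_i] on [S]; then [g_i ^ 2 = -1] for [i < r] and
    [g_i ^ 2 = 1] for [r <= i].

    Equivariant maps.  By parity a Nomizu map consists of four equivariant
    bilinear pieces: [V x V -> V], [V x S -> S], [S x V -> S] and
    [S x S -> V].  The first one is an invariant trilinear form on [V], and it
    vanishes because [n] is not 0, 1 or 3 ([trilinear_zero]; for [n = 3] the
    vector product survives).  The second and third ones are equivariant linear
    maps [phi : V -> End S].  Rotating the plane of [e_i, e_j] by an element
    [a + b e_i e_j] shows that [phi e_i] anticommutes with [g_i g_j] and
    determines [phi e_j]; it follows that [phi v] is Clifford multiplication
    by [v] combined with one operator [T] that commutes with all the products
    [g_i g_j] ([equivariant_clifford]).  Conversely every such [T] gives an
    equivariant map.  The fourth piece is of the same kind, because [S]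
    carries a nondegenerate bilinear form for which the [g_i] are all
    self-adjoint or all skew-adjoint ([spin_form]); the identity component of
    the spin group preserves it ([form_spin0]).  So if [K] is the commutant of
    the even products, the dimension sought is [3 dim K].

    The dimension of [K].  Averaging over the [2 ^ (n - 1)] even monomials
    projects [End S] onto [K].  The trace of this projection is
    [d ^ 2 / 2 ^ (n - 1)] with [d = dim S], since every even monomial other
    than 1 anticommutes with some generator and therefore has trace 0
    ([even_commutant]).

    The dimension of [S].  Averaging over all monomials [W] projects the
    bilinear forms on [S] onto the invariant ones.  The symmetric invariant
    forms are the multiples of one positive definite form: a suitable
    difference of two of them is degenerate, its kernel is a submodule, and
    [S] is irreducible.  Taking traces gives the Frobenius-Schur relation
    [2 ^ (n + 1) = sum_W (tr W) ^ 2 + sum_W tr (W ^ 2)] ([frobenius_schur]).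
    In the first sum only 1 and, for odd [n], the product of all generators
    contribute ([sqr_tr_volume]).  The second sum is [d] times the sum of the
    signs [W ^ 2 = +1] or [-1], which is the sum of the real and imaginary
    parts of [(1 - i) ^ r (1 + i) ^ s].  This Gaussian integer is a positive
    multiple of [(1 - i) ^ k] with [k = r - s mod 8]
    ([gauss_prod_signature]), and the resulting quadratic equation for [d]
    has a single positive root ([dim_even_commutant]).

    Operators on [S] are written as matrices acting on row vectors, so that
    products appear in reverse order. *)

(** * Traces of idempotents *)

Section Idem.
Variable R : numFieldType.

(** If [E = C B] with [C] of full column rank and [B] of full row rank, then
    [E E = E] forces [B C = 1], whose size is the rank of [E]. *)
Lemma mxtrace_idempotent (n : nat) (E : 'M[R]_n) :
  E *m E = E -> \tr E = (\rank E)%:R.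
Proof.
move=> EE; move: (mulmx_base E) (row_base_free E) (col_base_full E).
move: (row_base E) (col_base E) => B C EC freeB fullC.
rewrite -{1}EC mxtrace_mulC.
suff -> : B *m C = 1%:M by rewrite mxtrace1.
apply: (row_free_inj freeB); rewrite mul1mx.
apply: (row_full_inj fullC).
by rewrite !mulmxA EC -mulmxA EC.
Qed.

Lemma dim_limg (aT rT : vectType R) (f : 'Hom(aT, rT)) :
  \dim (limg f) = \rank (f2mx f).
Proof.
by rewrite unlock /dimv /= genmxE genmx1 mul1mx.
Qed.

Lemma dim_limg_idempotent (d : nat) (Q : {linear 'M[R]_d -> 'M[R]_d}) :
  (forall X, Q (Q X) = Q X) ->
  (\dim (limg (linfun Q)))%:R = \sum_i \sum_j Q (delta_mx i j) i j :> R.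
Proof.
move=> QQ; rewrite dim_limg -mxtrace_idempotent; last first.
  apply/row_matrixP=> i; rewrite row_mul !rowE unlock /=.
  by rewrite !mul_rV_lin1 /= v2rK QQ.
rewrite unlock /=.
(* [v2r] is an arbitrary isomorphism on matrices; [h] and [h'] are the changes
   of coordinates between it and [mxvec]. *)
pose h := lin1_mx (v2r \o (@vec_mx R d d)).
pose h' := lin1_mx ((@mxvec R d d) \o r2v).
have -> : lin1_mx (v2r \o Q \o r2v) = h' *m lin_mx Q *m h.
  apply/row_matrixP=> i; rewrite !row_mul !rowE !mul_rV_lin1 /=.
  by rewrite !mxvecK.
rewrite mxtrace_mulC mulmxA.
have -> : h *m h' = 1%:M.
  apply/row_matrixP=> i; rewrite row_mul !rowE !mul_rV_lin1 /= v2rK vec_mxK.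
  by rewrite mulmx1.
rewrite mul1mx pair_bigA /=.
rewrite /mxtrace (reindex (uncurry (@mxvec_index d d))) /=; last first.
  exact: curry_mxvec_bij.
apply: eq_bigr => -[i j] _ /=.
by rewrite !mxE /= !mxvecE vec_mx_delta.
Qed.
End Idem.

(** * Clifford systems of matrices and their monomials *)

Section Words.
Variables (R : realFieldType) (I : eqType) (d : nat).
Implicit Types (A B : I -> 'M[R]_d) (q : I -> R) (s w : seq I) (X : 'M[R]_d).

(** The words in [subwords s] index the monomials in the generators [s]. Up to
    signs these monomials form a finite group, so that averages over the group
    are sums over [subwords s]. *)
Fixpoint subwords s : seq (seq I) :=
  if s is i :: t then subwords t ++ map (cons i) (subwords t) else [:: [::]].

Lemma mem_subwords s w : (w \in subwords s) = subseq w s.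
Proof.
elim: s w => [|i s IH] [|j w] //=; first by rewrite mem_cat IH sub0seq.
rewrite mem_cat IH; case: eqVneq => [->|ne].
  rewrite mem_map ?IH; last by move=> ? ? [].
  apply/orP/idP => [[|//]|]; last by right.
  by move=> /(subseq_trans (subseq_cons w i)).
by rewrite orbC; case: mapP => // -[v _ [E]]; rewrite E eqxx in ne.
Qed.

Lemma uniq_subwords s : uniq s -> uniq (subwords s).
Proof.
elim: s => //= i s IH /andP[is_ us]; rewrite cat_uniq IH // map_inj_uniq ?IH //.
  rewrite andbT; apply/hasPn => _ /mapP[w _ ->]; rewrite mem_subwords.
  by apply: contra is_ => /mem_subseq /(_ i); rewrite mem_head; apply.
by move=> ? ? [].
Qed.

Definition word A w := foldr (fun i M => A i *m M) 1%:M w.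
Definition rword A w := foldr (fun i M => M *m A i) 1%:M w.

Lemma tr_word A w : (word A w)^T = rword (fun i => (A i)^T) w.
Proof. by elim: w => /= [|i w <-]; rewrite ?trmx1 // trmx_mul. Qed.

(** The sum of [A_w X B_(rev w)] over all subwords [w] of [s]. Adding one
    generator at a time gives the invariance under each generator without
    having to follow the sign in a product of two monomials. *)
Fixpoint sandwich_sum A B s X :=
  if s is i :: t then sandwich_sum A B t X + A i *m sandwich_sum A B t X *m B i else X.

Lemma sandwich_sum_linear A B s : linear (sandwich_sum A B s).
Proof.
elim: s => //= i s IH a X Y; rewrite IH mulmxDr mulmxDl -scalemxAr -scalemxAl.
by rewrite scalerDr addrACA.
Qed.
HB.instance Definition _ A B s :=
  GRing.isLinear.Build R 'M[R]_d 'M[R]_d _ (sandwich_sum A B s) (sandwich_sum_linear A B s).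

Lemma sandwich_sumE A B s X :
  sandwich_sum A B s X = \sum_(w <- subwords s) word A w *m X *m rword B w.
Proof.
elim: s X => /= [|i s IH] X; first by rewrite big_seq1 mul1mx mulmx1.
rewrite big_cat big_map /= IH mulmx_sumr mulmx_suml; congr (_ + _).
by apply: eq_bigr => w _; rewrite !mulmxA.
Qed.

Lemma sandwich_sum_fix A B s X : {in s, forall i, A i *m X *m B i = X} ->
  sandwich_sum A B s X = 2 ^+ size s *: X.
Proof.
elim: s => [|i s IH] h; first by rewrite scale1r.
rewrite /= IH => [|j js]; last by rewrite h // inE js orbT.
rewrite -scalemxAr -scalemxAl h ?mem_head // -scalerDl exprS.
by congr (_ *: _); rewrite mulr_natl mulr2n.
Qed.

Definition clifford_system A q s :=
  [/\ {in s, forall i, A i *m A i = (q i)%:M},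
      {in s &, forall i j, i != j -> A i *m A j = - (A j *m A i)}
    & {in s, forall i, q i * q i = 1}].

Lemma clifford_system_sub A q s t : {subset t <= s} -> clifford_system A q s -> clifford_system A q t.
Proof.
move=> sub [h1 h2 h3]; split.
- by move=> i /sub /h1.
- by move=> i j /sub si /sub sj; apply: h2.
- by move=> i /sub /h3.
Qed.

(** The two signs that appear when [A i] moves past [A j] on the left and [B i]
    past [B j] on the right cancel, so the steps of the sum commute. *)
Lemma sandwich_sum_inv A B q s : clifford_system A q s -> clifford_system B q s ->
  forall i X, i \in s -> A i *m sandwich_sum A B s X *m B i = sandwich_sum A B s X.
Proof.
elim: s => // j s IH cA cB i X.
have sub : {subset s <= j :: s} by move=> k; rewrite inE orbC => ->.
have{IH} IH := IH (clifford_system_sub sub cA) (clifford_system_sub sub cB).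
case: cA cB => sqA ac q1 [sqB acB _].
have [-> _|ne] := eqVneq i j.
  rewrite /= mulmxDr mulmxDl addrC; congr (_ + _).
  rewrite !mulmxA sqA ?mem_head // -!mulmxA sqB ?mem_head //.
  by rewrite mul_mx_scalar mul_scalar_mx scalerA q1 ?mem_head // scale1r.
rewrite inE (negPf ne) /= => si.
have ii : i \in j :: s by rewrite inE si orbT.
rewrite mulmxDr mulmxDl IH //; congr (_ + _).
rewrite !mulmxA (ac i j) ?mem_head // -!mulmxA (acB j i) ?mem_head //; last by rewrite eq_sym.
rewrite !mulmxN mulNmx opprK !mulmxA -!mulmxA; congr (_ *m _).
by rewrite !mulmxA IH.
Qed.

Lemma word_comm A j w : {in w, forall i, i != j -> A j *m A i = - (A i *m A j)} ->
  A j *m word A w = (-1) ^+ count (predC1 j) w *: (word A w *m A j).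
Proof.
elim: w => [|i w IH] h /=; first by rewrite mulmx1 mul1mx scale1r.
have [->|ne] := eqVneq i j; rewrite /= ?add0n.
  by rewrite {1}IH -?scalemxAr ?mulmxA // => k kw; apply: h; rewrite inE kw orbT.
rewrite mulmxA (h i) ?mem_head // mulNmx -[A i *m A j *m _]mulmxA IH; last first.
  by move=> k kw; apply: h; rewrite inE kw orbT.
by rewrite -scalemxAr -scaleN1r scalerA -exprS mulmxA.
Qed.

(** [U M U] has trace [c tr M] by cyclicity and [- c tr M] by anticommutation. *)
Lemma mxtrace_anticomm (U M : 'M[R]_d) (c : R) : c != 0 ->
  U *m U = c%:M -> U *m M = - (M *m U) -> \tr M = 0.
Proof.
move=> c0 UU h; have : \tr (U *m M *m U) = - (c * \tr M).
  by rewrite h mulNmx -mulmxA UU mul_mx_scalar raddfN /= mxtraceZ.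
rewrite mxtrace_mulC mulmxA UU mul_scalar_mx mxtraceZ => /eqP.
by rewrite -addr_eq0 -mulr2n mulrn_eq0 /= mulf_eq0 (negPf c0) => /eqP.
Qed.

(** The left-hand side is the trace of [sandwich_sum A B s] as an operator on
    matrices, and [X |-> W X W'] has trace [tr W tr W']. *)
Lemma sandwich_sum_trace A B s :
  \sum_i \sum_j sandwich_sum A B s (delta_mx i j) i j =
  \sum_(w <- subwords s) \tr (word A w) * \tr (rword B w).
Proof.
under eq_bigr => i _ do under eq_bigr => j _ do rewrite sandwich_sumE summxE.
under eq_bigr => i _ do rewrite exchange_big.
rewrite exchange_big /=; apply: eq_bigr => w _.
rewrite [\tr (word A w)]/mxtrace big_distrl /=; apply: eq_bigr => i _.
rewrite mulr_sumr; apply: eq_bigr => j _; rewrite -mulmxA.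
rewrite mxE (bigD1 i) //= big1 => [|k ki]; last first.
  by rewrite [X in _ * X]mxE big1 ?mulr0 // => l _; rewrite !mxE (negPf ki) mul0r.
rewrite addr0; congr (_ * _); rewrite mxE (bigD1 j) //= big1 => [|k kj].
  by rewrite mxE !eqxx mul1r addr0.
by rewrite mxE (negPf kj) andbF mul0r.
Qed.

(** The trace of [sandwich_sum] followed by transposition: the operator
    [X |-> (W X W^T)^T] has trace [tr (W W)]. *)
Lemma sandwich_sum_trace_tr A s :
  \sum_i \sum_j sandwich_sum A (fun k => (A k)^T) s (delta_mx i j) j i =
  \sum_(w <- subwords s) \tr (word A w *m word A w).
Proof.
under eq_bigr => i _ do under eq_bigr => j _ do rewrite sandwich_sumE summxE.
under eq_bigr => i _ do rewrite exchange_big.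
rewrite exchange_big /=; apply: eq_bigr => w _.
rewrite -tr_word exchange_big /mxtrace; apply: eq_bigr => j _.
rewrite mxE; apply: eq_bigr => i _; rewrite -mulmxA.
rewrite mxE (bigD1 i) //= big1 => [|k ki]; last first.
  by rewrite [X in _ * X]mxE big1 ?mulr0 // => l _; rewrite !mxE (negPf ki) mul0r.
rewrite addr0; congr (_ * _); rewrite mxE (bigD1 j) //= big1 => [|k kj].
  by rewrite !mxE !eqxx mul1r addr0.
by rewrite !mxE (negPf kj) andbF mul0r.
Qed.

(** The sign of the square of a product of anticommuting elements with squares
    [l]. *)
Fixpoint word_sign (l : seq R) : R :=
  if l is c :: t then (-1) ^+ size t * c * word_sign t else 1.

Lemma word_sqr A q s w : clifford_system A q s -> uniq w -> {subset w <= s} ->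
  word A w *m word A w = (word_sign (map q w))%:M.
Proof.
move=> [sqA ac q1]; elim: w => [_ _|i w IH] /=; first by rewrite mulmx1.
case/andP=> iw uw sub; have si : i \in s by rewrite sub ?mem_head.
have sw : {subset w <= s} by move=> k kw; rewrite sub // inE kw orbT.
rewrite mulmxA -[_ *m A i]mulmxA.
have cw : word A w *m A i = (-1) ^+ size w *: (A i *m word A w).
  rewrite word_comm => [|k kw ki]; last by rewrite ac ?(sw _ kw) // eq_sym.
  rewrite -[size w](count_predC (pred1 i)) scalerA -exprD.
  have -> : count (pred1 i) w = 0%N by apply/count_memPn.
  rewrite add0n; set c := count _ _.
  by rewrite addnn -mul2n exprM sqrrN expr1n expr1n scale1r.
rewrite cw -scalemxAr mulmxA sqA // -scalemxAl -mulmxA IH //.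
by rewrite size_map -scalar_mxM -[LHS]mul_scalar_mx -scalar_mxM mulrA.
Qed.

Lemma count_full w i : i \in w -> uniq w -> (count (predC1 i) w).+1 = size w.
Proof.
move=> iw uw; rewrite -(count_predC (pred1 i) w) count_uniq_mem // iw.
by rewrite addnC addn1.
Qed.

(** A nonempty word of even length anticommutes with each of its letters. *)
Lemma tr_word_even A q s w : clifford_system A q s -> uniq w -> {subset w <= s} ->
  w != [::] -> ~~ odd (size w) -> \tr (word A w) = 0.
Proof.
case: w => // i w [sqA ac q1] uw sub _ evw.
have si : i \in s by rewrite sub ?mem_head.
apply: (@mxtrace_anticomm (A i) _ (q i)); last 1 first.
- rewrite word_comm => [|k kw ki]; last by apply: ac => //; [exact: sub | rewrite eq_sym].
  have := count_full (mem_head i w) uw; set c := count _ _ => cE.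
  by rewrite -cE /= negbK in evw; rewrite -signr_odd evw scaleN1r.
- by apply: contraTneq (oner_neq0 R) => q0; rewrite -(q1 i) // q0 mul0r eqxx.
- exact: sqA.
Qed.

(** A word of odd length anticommutes with each letter that it omits. *)
Lemma tr_word_odd A q s w j : clifford_system A q s -> {subset w <= s} ->
  j \in s -> j \notin w -> odd (size w) -> \tr (word A w) = 0.
Proof.
move=> [sqA ac q1] sub sj jw od.
apply: (@mxtrace_anticomm (A j) _ (q j)); last 1 first.
- rewrite word_comm => [|k kw ki]; last by apply: ac => //; [exact: sub | rewrite eq_sym].
  suff -> : count (predC1 j) w = size w by rewrite -signr_odd od scaleN1r.
  apply/eqP; rewrite -all_count; apply/allP => k kw /=.
  by apply: contraNneq jw => <-.
- by apply: contraTneq (oner_neq0 R) => q0; rewrite -(q1 j) // q0 mul0r eqxx.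
- exact: sqA.
Qed.

Lemma sum_pred1_seq (T : eqType) (r : seq T) x (F : T -> R) :
  uniq r -> x \in r -> \sum_(w <- r | w == x) F w = F x.
Proof. by move=> ur xr; rewrite -big_filter filter_pred1_uniq // big_seq1. Qed.

Lemma sum_tr_word_sqr A q s : clifford_system A q s -> uniq s -> s != [::] ->
  \sum_(w <- subwords s) \tr (word A w) ^+ 2 =
  d%:R ^+ 2 + (if odd (size s) then \tr (word A s) ^+ 2 else 0).
Proof.
move=> cA us s0.
rewrite (eq_big_seq (fun w => (if w == [::] then d%:R ^+ 2 else 0) +
    (if w == s then (if odd (size s) then \tr (word A s) ^+ 2 else 0) else 0))).
  rewrite big_split -!big_mkcond /= !sum_pred1_seq ?uniq_subwords //.
    by rewrite mem_subwords subseq_refl.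
  by rewrite mem_subwords sub0seq.
move=> w; rewrite mem_subwords => sws /=.
have sub := mem_subseq sws; have uw := subseq_uniq sws us.
have [->|w0] := eqVneq w [::]; first by rewrite eq_sym (negPf s0) mxtrace1 addr0.
rewrite add0r; case: (boolP (odd (size w))) => od; last first.
  rewrite (tr_word_even cA uw sub w0 od) expr0n /=.
  by case: eqVneq => // <-; rewrite (negPf od).
case: eqVneq => [<-|ne]; first by rewrite od.
have /hasP[j sj jw] : has [predC w] s.
  rewrite has_predC; apply: contra ne => /allP sw.
  rewrite -(size_subseq_leqif sws) eqn_leq size_subseq //.
  by apply: uniq_leq_size.
by rewrite (tr_word_odd cA sub sj jw od) expr0n.
Qed.

Lemma tr_word_sqr A q s : clifford_system A q s -> uniq s ->
  \sum_(w <- subwords s) \tr (word A w *m word A w) =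
  d%:R * \sum_(w <- subwords s) word_sign (map q w).
Proof.
move=> cA us; rewrite mulr_sumr; apply: eq_big_seq => w; rewrite mem_subwords => sws.
rewrite (word_sqr cA (subseq_uniq sws us) (mem_subseq sws)).
by rewrite mxtrace_scalar mulr_natl.
Qed.

(** The real and imaginary parts of the product of the [1 + i c] for [c] in
    [l]. *)
Fixpoint gauss_prod (l : seq R) : R * R :=
  if l is c :: t then ((gauss_prod t).1 - c * (gauss_prod t).2, (gauss_prod t).2 + c * (gauss_prod t).1)
  else (1, 0).

(** Expanding the product of the [1 + i c], a word of length [k] contributes
    [i ^ k] times the product of its entries. Its sign as a square is
    [(-1) ^ (k (k - 1) / 2)] times the same product, and
    [(-1) ^ (k (k - 1) / 2)] is the real part of [i ^ k] if [k] is even and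
    the imaginary part if [k] is odd. *)
Lemma gauss_prodE q s : gauss_prod (map q s) =
  (\sum_(w <- subwords s | ~~ odd (size w)) word_sign (map q w),
   \sum_(w <- subwords s | odd (size w)) word_sign (map q w)).
Proof.
elim: s => [|i s IH] /=; first by rewrite !big_cons !big_nil /= addr0.
rewrite IH /= !big_cat !big_map /= !mulr_sumr -sumrN; congr (_ + _, _ + _).
  apply: eq_big => w /=; first by rewrite negbK.
  by rewrite size_map => od; rewrite -signr_odd od expr1 !mulNr !mul1r.
by apply: eq_bigr => w /negPf evw; rewrite size_map -signr_odd evw mul1r.
Qed.

Lemma sum_word_sign q s :
  \sum_(w <- subwords s) word_sign (map q w) = (gauss_prod (map q s)).1 + (gauss_prod (map q s)).2.
Proof. by rewrite gauss_prodE /= addrC (bigID (fun w => odd (size w))). Qed.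

(** [(1 - i) ^ r (1 + i) ^ s] is a positive multiple of [(1 - i) ^ k] for
    [k = r - s mod 8], because [(1 - i) (1 + i) = 2] and [(1 - i) ^ 8 = 16].
    The first two tables are the real and imaginary parts of [(1 - i) ^ k];
    the last one is the square of the product of all generators. *)
Lemma gauss_prod_signature (r s : nat) :
  let l := nseq r (-1) ++ nseq s 1 in
  exists k a b : nat, exists m : R,
  [/\ (k < 8)%N, (r + 8 * a = s + k + 8 * b)%N, 0 < m, m ^+ 2 * 2 ^+ k = 2 ^+ (r + s)
    & gauss_prod l = (m * nth 0 [:: 1; 1; 0; -2; -4; -4; 0; 8] k,
             m * nth 0 [:: 0; -1; -2; -2; 0; 4; 8; 8] k) /\
    word_sign l = nth 0 [:: 1; -1; -1; 1; 1; -1; -1; 1] k].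
Proof.
have signX n k : odd n = odd k -> (-1) ^+ n = (-1) ^+ k :> R.
  by move=> e; rewrite -signr_odd e signr_odd.
elim: r => [|r IH] /=.
  elim: s => [|s IH] /=.
    exists 0%N, 0%N, 0%N, 1; split=> //=; first by rewrite expr1n mul1r.
    by rewrite mulr1 mulr0; split.
  have [k [a [b [m [k8 rs m0 mk [-> ->]]]]]] := IH.
  have pk : odd s = odd k by lia.
  rewrite size_nseq (signX _ _ pk) add0n exprS -[s in 2 ^+ s]add0n -mk.
  case: k k8 rs mk pk => [|k] k8 rs mk pk.
    (* (1 + i) = (1 - i) ^ 7 / 8 *)
    exists 7%N, a.+1, b, (m / 8); split=> //=; [lia|lra|by field|split; [by congr (_, _); field|ring]].
  (* (1 - i) (1 + i) = 2 *)
  exists k, a, b, (2 * m); split=> //=; [lia|lia|lra|by rewrite (exprS 2 k); ring|split].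
    by clear rs mk pk; do 7![case: k k8 => [|k] k8 /=; first by congr (_, _); ring].
  by clear rs mk pk; do 7![case: k k8 => [|k] k8 /=; first by ring].
have [k [a [b [m [k8 rs m0 mk [-> ->]]]]]] := IH.
have pk : odd (r + s) = odd k by lia.
rewrite size_cat !size_nseq (signX _ _ pk) addSn exprS -mk.
have [k7|k7] := eqVneq k 7%N.
  (* (1 - i) ^ 8 = 16 *)
  exists 0%N, a, b.+1, (16 * m); split=> //=; [lia|lra|rewrite k7; ring|split].
    by rewrite k7 /=; congr (_, _); ring.
  by rewrite k7 /=; ring.
clear mk pk; exists k.+1, a, b, m; split=> //=; [lia|lia|by rewrite (exprS 2 k); ring|clear rs; split].
  do 7![case: k k7 k8 => [|k] k7 k8 /=; first by congr (_, _); ring]. by case: k k7 k8.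
do 7![case: k k7 k8 => [|k] k7 k8 /=; first by ring]. by case: k k7 k8.
Qed.

End Words.

(** * Symmetric matrices and definite forms *)

Section Forms.
Variable R : rcfType.

Definition posdef d (G : 'M[R]_d) :=
  forall v : 'rV_d, v != 0 -> 0 < (v *m G *m v^T) 0 0.

(** Over the complex numbers [X G^-1] has an eigenvector [x + i y], with
    eigenvalue [mu]. Comparing [x X y^T] with [y X x^T] gives
    [Im mu * (x G x^T + y G y^T) = 0], so [mu] is real, and [x] or [y] is the
    vector sought. *)
Lemma symmetric_pencil d (G X : 'M[R]_d) : (0 < d)%N -> posdef G ->
  G^T = G -> X^T = X ->
  exists a, exists2 v : 'rV_d, v != 0 & v *m (X - a *: G) = 0.
Proof.
move=> d0 pG sG sX.
have uG : G \in unitmx.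
  rewrite -row_free_unit -kermx_eq0; apply/rowV0P => v /sub_kermxP vG.
  by apply: contraTeq isT => /pG; rewrite vG mul0mx mxE ltxx.
pose f := real_complex R.
have [mu] : exists mu, root (char_poly (map_mx f (X *m invmx G))) mu.
  by apply/closed_rootP; rewrite size_char_poly; case: d d0 {G X pG sG sX uG}.
rewrite -eigenvalue_root_char => /eigenvalueP[v vM v0].
have reM (w : 'rV[R[i]]_d) (M : 'M[R]_d) :
    map_mx (@complex.Re R) (w *m map_mx f M) = map_mx (@complex.Re R) w *m M.
  apply/rowP => j; rewrite !mxE raddf_sum; apply: eq_bigr => k _.
  by rewrite !mxE; case: (w 0 k) => x y /=; rewrite mulr0 subr0.
have imM (w : 'rV[R[i]]_d) (M : 'M[R]_d) :
    map_mx (@complex.Im R) (w *m map_mx f M) = map_mx (@complex.Im R) w *m M.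
  apply/rowP => j; rewrite !mxE raddf_sum; apply: eq_bigr => k _.
  by rewrite !mxE; case: (w 0 k) => x y /=; rewrite mulr0 add0r.
have {vM} vX : v *m map_mx f X = mu *: v *m map_mx f G.
  by rewrite -vM -mulmxA -map_mxM mulmxKV.
have eR := congr1 (map_mx (@complex.Re R)) vX; have eI := congr1 (map_mx (@complex.Im R)) vX.
rewrite !reM in eR; rewrite !imM in eI.
pose x := map_mx (@complex.Re R) v; pose y := map_mx (@complex.Im R) v.
have xE : map_mx (@complex.Re R) (mu *: v) = complex.Re mu *: x - complex.Im mu *: y.
  by apply/rowP => j; rewrite !mxE; case: (mu) (v 0 j) => [? ?] [? ?].
have yE : map_mx (@complex.Im R) (mu *: v) = complex.Im mu *: x + complex.Re mu *: y.
  by apply/rowP => j; rewrite !mxE addrC; case: (mu) (v 0 j) => [? ?] [? ?].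
rewrite {}xE -/x in eR; rewrite {}yE -/y in eI.
have xy0 : x != 0 \/ y != 0.
  have [x0|] := eqVneq x 0; last by left.
  have [y0|] := eqVneq y 0; last by right.
  move/eqP: v0 => []; apply/rowP => j.
  have := congr1 (fun w : 'rV_d => w 0 j) x0; have := congr1 (fun w : 'rV_d => w 0 j) y0.
  by rewrite !mxE; case: (v 0 j) => ? ? /= -> ->.
have nn (w : 'rV_d) : 0 <= (w *m G *m w^T) 0 0.
  by have [->|/pG/ltW//] := eqVneq w 0; rewrite !mul0mx mxE.
have symE (M : 'M[R]_d) (w z : 'rV_d) : M^T = M ->
    (w *m M *m z^T) 0 0 = (z *m M *m w^T) 0 0.
  move=> sM; have -> : z *m M *m w^T = (w *m M *m z^T)^T.
    by rewrite !trmx_mul trmxK sM mulmxA.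
  by rewrite [RHS]mxE.
have b0 : complex.Im mu = 0.
  have entryD a b (M N : 'M[R]_1) : (a *: M + b *: N) 0 0 = a * M 0 0 + b * N 0 0.
    by rewrite !mxE.
  have := symE X x y sX; rewrite eR eI -scaleNr !mulmxDl -!scalemxAl !entryD.
  rewrite (symE G x y sG).
  have px := nn x; have py := nn y.
  move=> e; have : complex.Im mu * ((x *m G *m x^T) 0 0 + (y *m G *m y^T) 0 0) = 0.
    lra.
  move/eqP; rewrite mulf_eq0 => /orP[/eqP//|].
  rewrite paddr_eq0 // => /andP[/eqP zx /eqP zy].
  by case: xy0 => /pG; rewrite ?zx ?zy ltxx.
rewrite b0 !scale0r ?subr0 ?add0r in eR eI.
by exists (complex.Re mu); case: xy0 => h; [exists x | exists y];
  rewrite // mulmxBr ?eR ?eI -scalemxAr -scalemxAl subrr.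
Qed.

End Forms.

(** * Invariant forms of an irreducible Clifford system *)

Section Schur.
Variables (R : rcfType) (I : eqType) (d : nat) (A : I -> 'M[R]_d) (q : I -> R).
Variable (s : seq I).

(** The rows of [U] span the invariant subspace. *)
Definition mx_irreducible := forall U : 'M[R]_d,
  {in s, forall i, (U *m A i <= U)%MS} -> U != 0 -> row_full U.

Hypotheses (d0 : (0 < d)%N) (cA : clifford_system A q s) (us : uniq s) (s0 : s != [::]).
Hypothesis irr : mx_irreducible.

Let At i := (A i)^T.

Lemma clifford_system_tr : clifford_system At q s.
Proof.
case: cA => sq ac q1; split=> // [i si|i j si sj ij].
  by rewrite -trmx_mul sq // tr_scalar_mx.
by rewrite -!trmx_mul ac // 1?eq_sym // linearN.
Qed.

Lemma sandwich_sum_trmx (t : seq I) X : (sandwich_sum A At t X)^T = sandwich_sum A At t X^T.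
Proof.
elim: t => //= i t IH.
by rewrite linearD /= !trmx_mul trmxK IH mulmxA.
Qed.

Lemma sandwich_sum_posdef (t : seq I) X : posdef X -> posdef (sandwich_sum A At t X).
Proof.
move=> pX; elim: t => //= i t IH v v0.
rewrite mulmxDr mulmxDl mxE ltr_wpDr ?IH // !mulmxA -mulmxA -trmx_mul.
by have [->|/IH/ltW//] := eqVneq (v *m A i) 0; rewrite !mul0mx mxE.
Qed.

(** The standard inner product summed over all monomials: a positive definite
    form that is invariant under each generator. *)
Definition gram := sandwich_sum A At s 1%:M.

Lemma gram_posdef : posdef gram.
Proof.
apply: sandwich_sum_posdef => v v0; rewrite mulmx1.
rewrite mxE lt_neqAle sumr_ge0 => [|i _]; last by rewrite mxE -expr2 sqr_ge0.
rewrite andbT eq_sym; apply: contraNneq v0 => /eqP.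
rewrite psumr_eq0 => [/allP v0|i _]; last by rewrite mxE -expr2 sqr_ge0.
apply/eqP/rowP => j; have := v0 j; rewrite mem_index_enum => /(_ isT) /=.
by rewrite !mxE mulf_eq0 orbb => /eqP.
Qed.

Lemma posdef_unit (G : 'M[R]_d) : posdef G -> G \in unitmx.
Proof.
move=> pG; rewrite -row_free_unit -kermx_eq0; apply/rowV0P => v /sub_kermxP vG.
by apply: contraTeq isT => /pG; rewrite vG mul0mx mxE ltxx.
Qed.

Lemma gram_tr : gram^T = gram.
Proof. by rewrite sandwich_sum_trmx trmx1. Qed.

Lemma gram_inv i : i \in s -> A i *m gram *m At i = gram.
Proof. exact: (sandwich_sum_inv cA clifford_system_tr). Qed.

Lemma invariant_comm X i : i \in s -> A i *m X *m At i = X ->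
  A i *m X = q i *: (X *m At i).
Proof.
move=> si iX; case: clifford_system_tr => sq _ q1.
rewrite -[in RHS]iX -!mulmxA sq // !mul_mx_scalar -scalemxAr.
by rewrite scalerA q1 // scale1r.
Qed.

(** A degenerate form [X - a G] has an invariant kernel, which is the whole
    space by irreducibility. *)
Lemma invariant_form_scalar X : X^T = X ->
  {in s, forall i, A i *m X *m At i = X} -> exists a, X = a *: gram.
Proof.
move=> sX iX; have [a [v v0 vY]] := symmetric_pencil d0 gram_posdef gram_tr sX.
exists a; apply/eqP; rewrite -subr_eq0; set Y := X - _ in vY *.
have YA i : i \in s -> A i *m Y *m At i = Y.
  by move=> si; rewrite mulmxBr mulmxBl iX // -scalemxAr -scalemxAl gram_inv.
have : row_full (kermx Y).
  apply: irr => [i si|]; last first.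
    by apply: contraNneq v0 => K0; rewrite -submx0 -K0; apply/sub_kermxP.
  apply/sub_kermxP; rewrite -mulmxA (invariant_comm si (YA i si)).
  by rewrite -scalemxAr mulmxA mulmx_ker mul0mx scaler0.
by rewrite -sub1mx => /sub_kermxP; rewrite mul1mx => ->.
Qed.

(** The operator [Q] of the proof projects matrices onto the symmetric invariant
    forms. These form the line through [gram], so the trace of [Q] is 1. *)
Lemma frobenius_schur :
  2 ^+ (size s).+1 =
  \sum_(w <- subwords s) \tr (word A w) ^+ 2 +
  \sum_(w <- subwords s) \tr (word A w *m word A w) :> R.
Proof.
pose Q X : 'M[R]_d := (2 ^+ (size s).+1)^-1 *: (sandwich_sum A At s X + (sandwich_sum A At s X)^T).
have Qlin : linear Q.
  move=> a X Y; rewrite /Q !linearP /= addrACA -[a *: _ + a *: _]scalerDr.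
  by rewrite [LHS]scalerDr scalerA mulrC -scalerA.
pose Ql : {linear 'M[R]_d -> 'M[R]_d} := HB.pack Q (GRing.isLinear.Build _ _ _ _ Q Qlin).
have Qs X : (Q X)^T = Q X.
  by rewrite /Q linearZ /= linearD /= trmxK addrC.
have Qi X : {in s, forall i, A i *m Q X *m At i = Q X}.
  move=> i si; rewrite /Q sandwich_sum_trmx -scalemxAr -scalemxAl mulmxDr mulmxDl.
  by rewrite !(sandwich_sum_inv cA clifford_system_tr).
have c0 : (2 ^+ (size s).+1) != 0 :> R by rewrite expf_neq0 // pnatr_eq0.
have Qfix X : X^T = X -> {in s, forall i, A i *m X *m At i = X} -> Q X = X.
  move=> sX iX; rewrite /Q sandwich_sum_trmx sX (sandwich_sum_fix iX) -scalerDl scalerA.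
  by rewrite (_ : _ + _ = 2 ^+ (size s).+1) ?mulVf ?scale1r // exprS; ring.
have QQ X : Q (Q X) = Q X by apply: Qfix.
have := @dim_limg_idempotent _ _ Ql QQ.
have -> : limg (linfun Ql) = <[gram]>%VS.
  apply/vspaceP => X; apply/memv_imgP/vlineP => [[Y _ ->]|[a ->]].
    by rewrite lfunE /=; apply: invariant_form_scalar.
  exists (a *: gram); rewrite ?memvf // lfunE linearZ /=; congr (_ *: _).
  by rewrite Qfix // ?gram_tr // => i; apply: gram_inv.
rewrite dim_vline; have -> : gram != 0.
  apply: contraTneq (posdef_unit gram_posdef) => ->.
  by rewrite -row_free_unit /row_free mxrank0 eq_sym -lt0n d0.
rewrite /= => /(congr1 ( *%R (2 ^+ (size s).+1))); rewrite mulr1 => ->.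
under eq_bigr => i _ do under eq_bigr => j _ do rewrite !mxE.
under eq_bigr => i _ do rewrite -mulr_sumr.
rewrite -mulr_sumr mulVKf //.
transitivity (\sum_i \sum_j sandwich_sum A At s (delta_mx i j) i j +
              \sum_i \sum_j sandwich_sum A At s (delta_mx i j) j i).
  by rewrite -big_split; apply: eq_bigr => i _; rewrite -big_split.
rewrite sandwich_sum_trace sandwich_sum_trace_tr; congr (_ + _).
by apply: eq_bigr => w _; rewrite -tr_word mxtrace_tr.
Qed.

End Schur.

(** * The volume element and the even commutant *)

Section Volume.
Variables (R : rcfType) (I : eqType) (d : nat) (A : I -> 'M[R]_d) (q : I -> R).
Variable (s : seq I).
Hypotheses (d0 : (0 < d)%N) (cA : clifford_system A q s) (us : uniq s).
Hypothesis irr : mx_irreducible A s.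

Lemma word_gram w : {subset w <= s} ->
  word A w *m gram A s *m (word A w)^T = gram A s.
Proof.
elim: w => [_|i w IH sub] /=; first by rewrite mul1mx trmx1 mulmx1.
rewrite trmx_mul !mulmxA -[A i *m _ *m _]mulmxA -[A i *m _ *m _]mulmxA IH.
  by apply: (gram_inv cA); rewrite sub ?mem_head.
by move=> k kw; rewrite sub // inE kw orbT.
Qed.

(** The product [W] of an odd number of generators is central. If [W W = 1] then
    irreducibility gives [W = 1] or [W = -1]; if [W W = -1] then [W] is skew
    with respect to [gram] and has trace 0. *)
Lemma sqr_tr_volume : odd (size s) ->
  \tr (word A s) ^+ 2 = (1 + word_sign (map q s)) / 2 * d%:R ^+ 2.
Proof.
move=> od; set W := word A s.
have WW : W *m W = (word_sign (map q s))%:M := word_sqr cA us (fun i h => h).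
have uG := posdef_unit (gram_posdef A s).
have : word_sign (map q s) = 1 \/ word_sign (map q s) = -1.
  have [_ _ q1] := cA.
  elim: (s) q1 => [|i t IH] q1 /=; first by left.
  have /IH : {in t, forall i, q i * q i = 1}.
    by move=> k kt; rewrite q1 // inE kt orbT.
  have : q i = 1 \/ q i = -1.
    have /eqP := q1 i (mem_head _ _); rewrite -expr2 sqrf_eq1.
    by case/orP => /eqP; [left|right].
  rewrite -signr_odd; case: odd.
    by move=> [->|->] [->|->]; rewrite ?expr1 ?expr0 ?mul1r ?mulr1 ?mulrN1 ?opprK; tauto.
  by move=> [->|->] [->|->]; rewrite ?expr1 ?expr0 ?mul1r ?mulr1 ?mulrN1 ?opprK; tauto.
case=> e; rewrite e in WW *.
  have cW i : i \in s -> A i *m W = W *m A i.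
    move=> si; rewrite (word_comm (A := A) (j := i)) => [|k sk ki].
      have := count_full si us; set c := count _ _ => cE.
      by rewrite -cE /= in od; rewrite -signr_odd (negPf od) scale1r.
    by case: cA => _ ac _; apply: ac => //; rewrite eq_sym.
  have [K0|K0] := eqVneq (kermx (W - 1%:M)) 0.
    have fr : row_free (W - 1%:M) by rewrite -kermx_eq0 K0.
    have W1 : W + 1%:M = 0.
      apply: (row_free_inj fr); rewrite mul0mx mulmxBr mulmxDl WW !mulmx1 mul1mx.
      by rewrite [X in X - _]addrC subrr.
    have -> : W = - 1%:M by apply/eqP; rewrite -addr_eq0 W1.
    by rewrite raddfN /= mxtrace1 sqrrN; field.
  have : row_full (kermx (W - 1%:M)).
    apply: irr K0 => i si; apply/sub_kermxP.
    by rewrite -mulmxA mulmxBr cW // mulmx1 -{2}[A i]mul1mx -mulmxBl mulmxA mulmx_ker mul0mx.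
  rewrite -sub1mx => /sub_kermxP; rewrite mul1mx => /eqP; rewrite subr_eq0 => /eqP ->.
  by rewrite mxtrace1; field.
suff -> : \tr W = 0 by rewrite subrr mul0r mul0r expr0n.
have WG : W *m gram A s = - (gram A s *m W^T).
  rewrite -[in LHS](word_gram (fun i h => h)) -/W !mulmxA WW.
  by rewrite mul_scalar_mx scaleN1r mulNmx.
have : \tr W = - \tr W.
  rewrite -{1}[W](mulmxK uG) WG mulNmx raddfN /= mxtrace_mulC mulmxA mulVmx //.
  by rewrite mul1mx mxtrace_tr.
by move/eqP; rewrite -addr_eq0 -mulr2n mulrn_eq0 /= => /eqP.
Qed.

End Volume.

Section Commutant.
Variables (R : realFieldType) (I : eqType) (d : nat) (A : I -> 'M[R]_d) (q : I -> R).
Variables (s : seq I) (i0 : I).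
Hypotheses (cA : clifford_system A q s) (us : uniq s) (i0s : i0 \in s).

(** For a fixed generator [A i0] the products [F j = A i0 A j] with [j != i0]
    form another Clifford system, and they generate the even products. So the
    even commutant is the image of the average of [X |-> F_w X F_w^-1] over the
    words in the [F j]. All words other than the empty one have trace 0: a word
    of even length anticommutes with its letters, a word of odd length with
    [A i0]. *)
Lemma even_commutant : exists K : {vspace 'M[R]_d},
  (forall T, T \in K <->
     {in s &, forall i j, T *m (A i *m A j) = A i *m A j *m T}) /\
  (\dim K * 2 ^ (size s).-1)%N = (d ^ 2)%N.
Proof.
pose t := [seq i <- s | i != i0].
have ts : {subset t <= s} by move=> i; rewrite mem_filter => /andP[].
have tn i : i \in t -> i != i0 by rewrite mem_filter => /andP[].
have st : size t = (size s).-1.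
  by rewrite size_filter -(count_full i0s us).
have [sqA ac q1] := cA.
pose q' i := - (q i0 * q i).
pose F i := A i0 *m A i.
have [B BE] : exists B, forall i, B i = q' i *: F i by exists (fun i => q' i *: F i).
have q'1 i : i \in s -> q' i * q' i = 1.
  by move=> si; rewrite /q' mulrNN mulrACA !q1 // mulr1.
have F0 i : i \in t -> A i0 *m F i = - (F i *m A i0).
  move=> ti; have si := ts _ ti; rewrite /F -[A i0 *m A i *m A i0]mulmxA -mulmxN.
  by rewrite -ac // eq_sym tn.
have cF : clifford_system F q' t.
  split=> [i ti|i j ti tj ij|i /ts/q'1//].
    rewrite {2}/F mulmxA.
    have -> : F i *m A i0 = - (q i0 *: A i).
      by rewrite -[LHS]opprK -F0 // /F mulmxA sqA // mul_scalar_mx.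
    rewrite mulNmx -scalemxAl sqA ?ts // -scalemx1 scalerA -scaleNr.
    by rewrite scalemx1.
  rewrite {2}/F {3}/F !mulmxA.
  have FA k : k \in t -> F k *m A i0 = - (q i0 *: A k).
    by move=> tk; rewrite -[LHS]opprK -F0 // /F mulmxA sqA // mul_scalar_mx.
  by rewrite !FA // !mulNmx -!scalemxAl ac ?ts // scalerN.
have cB : clifford_system B q' t.
  have [sqF acF _] := cF; split=> [i ti|i j ti tj ij|i /ts/q'1//].
    by rewrite BE -scalemxAr -scalemxAl scalerA sqF // q'1 ?ts // scale1r.
  by rewrite !BE -!scalemxAr -!scalemxAl acF // !scalerN !scalerA mulrC.
have ut : uniq t by rewrite filter_uniq.
pose c : R := (2 ^+ size t)^-1.
have c0 : 2 ^+ size t != 0 :> R by rewrite expf_neq0 // pnatr_eq0.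
pose Q X : 'M[R]_d := c *: sandwich_sum F B t X.
have Qlin : linear Q.
  by move=> a X Y; rewrite /Q linearP scalerDr !scalerA mulrC.
pose Ql : {linear 'M[R]_d -> 'M[R]_d} := HB.pack Q (GRing.isLinear.Build _ _ _ _ Q Qlin).
have Qi X i : i \in t -> F i *m Q X *m B i = Q X.
  by move=> ti; rewrite /Q -scalemxAr -scalemxAl (sandwich_sum_inv cF cB).
have Qfix X : {in t, forall i, F i *m X *m B i = X} -> Q X = X.
  by move=> iX; rewrite /Q (sandwich_sum_fix iX) scalerA mulVf // scale1r.
have BF i : i \in t -> B i *m F i = 1%:M.
  move=> ti; have [sqF _ _] := cF.
  by rewrite BE -scalemxAl sqF // scale_scalar_mx q'1 ?ts.
have comE T i : i \in t -> (F i *m T *m B i = T) <-> (T *m F i = F i *m T).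
  move=> ti; split=> [e|e]; first by rewrite -{1}e -[LHS]mulmxA BF // mulmx1.
  by rewrite -e -mulmxA (mulmx1C (BF i ti)) mulmx1.
exists (limg (linfun Ql)); split=> [T|].
  split=> [/memv_imgP[X _ ->]|com].
    rewrite lfunE /=.
    have com0 j : j \in s -> Q X *m (A i0 *m A j) = A i0 *m A j *m Q X.
      move=> sj; have [->|ne] := eqVneq j i0.
        by rewrite sqA // mul_mx_scalar mul_scalar_mx.
      have tj : j \in t by rewrite mem_filter ne.
      exact/comE/Qi.
    have com1 i : i \in s -> Q X *m (A i *m A i0) = A i *m A i0 *m Q X.
      move=> si; have [->|ne] := eqVneq i i0; first exact: com0.
      by rewrite ac // mulmxN mulNmx com0.
    move=> i j si sj.
    have -> : A i *m A j = q i0 *: (A i *m A i0 *m (A i0 *m A j)).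
      rewrite -mulmxA [A i0 *m (_ *m _)]mulmxA sqA // mul_scalar_mx.
      by rewrite -scalemxAr scalerA q1 // scale1r.
    rewrite -scalemxAr -scalemxAl; congr (_ *: _).
    rewrite [Q X *m (_ *m (A i0 *m A j))]mulmxA com1 //.
    by rewrite -[_ *m Q X *m _]mulmxA com0 // !mulmxA.
  apply/memv_imgP; exists T; rewrite ?memvf // lfunE /= Qfix // => i ti.
  by apply/comE => //; apply: com => //; apply: ts.
have tr0 w : w \in subwords t -> w != [::] -> \tr (word F w) = 0.
  rewrite mem_subwords => ws w0; have sub := mem_subseq ws.
  have [od|evw] := boolP (odd (size w)); last first.
    exact: tr_word_even cF (subseq_uniq ws ut) sub w0 evw.
  have qi0 : q i0 != 0.
    by apply: contraTneq (oner_neq0 R) => q0; rewrite -(q1 i0) // q0 mul0r eqxx.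
  apply: (mxtrace_anticomm qi0 (sqA _ i0s)).
  have -> : A i0 *m word F w = (-1) ^+ size w *: (word F w *m A i0).
    elim: (w) sub => [|j v IH] sub /=; first by rewrite mulmx1 mul1mx scale1r.
    rewrite mulmxA F0 ?sub ?mem_head // mulNmx.
    rewrite -(mulmxA (F j) (A i0)) IH.
      by rewrite -scalemxAr -scaleN1r scalerA -exprS mulmxA.
    by move=> k kv; rewrite sub // inE kv orbT.
  by rewrite -signr_odd od expr1 scaleN1r.
have := @dim_limg_idempotent _ _ Ql (fun X => Qfix _ (Qi X)).
rewrite /= => dE; apply/eqP; rewrite -(eqr_nat R) natrM dE natrX -st.
under eq_bigr => i _ do under eq_bigr => j _ do rewrite mxE.
under eq_bigr => i _ do rewrite -mulr_sumr.
rewrite -mulr_sumr mulrAC natrX mulVf // mul1r sandwich_sum_trace.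
rewrite (bigD1_seq [::]) ?uniq_subwords ?mem_subwords ?sub0seq //= mxtrace1.
rewrite big_seq_cond big1 => [|w /andP[ws w0]]; last by rewrite tr0 // mul0r.
by rewrite addr0 expr2.
Qed.

End Commutant.

(** * Systems of signature (r, s) *)

Section Signature.
Variables (R : rcfType) (r s d : nat).

(** The square of the [i]-th generator; it is opposite to the value of the inner
    product because [v v = - <v, v>]. *)
Definition gen_sign (i : 'I_(r + s)) : R := if (i < r)%N then -1 else 1.

Lemma map_gen_sign : map gen_sign (enum 'I_(r + s)) = nseq r (-1) ++ nseq s 1.
Proof.
apply: (@eq_from_nth _ 0) => [|i]; rewrite size_map size_enum_ord.
  by rewrite size_cat !size_nseq.
move=> hi; rewrite (nth_map (Ordinal hi)) ?size_enum_ord // /gen_sign nth_enum_ord //.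
rewrite nth_cat size_nseq !nth_nseq; case: ltnP => // ri.
by rewrite ltn_subLR // hi.
Qed.

Variable A : 'I_(r + s) -> 'M[R]_d.
Hypotheses (d0 : (0 < d)%N) (cA : clifford_system A gen_sign (enum 'I_(r + s))).
Hypothesis irr : mx_irreducible A (enum 'I_(r + s)).
Hypothesis n0 : (0 < r + s)%N.

(** With [m] and [k] from [gauss_prod_signature], the Frobenius-Schur relation
    is a quadratic equation for [d / m] whose coefficients depend on [k] only.
    It has one positive root, and [dim K * 2 ^ n = 2 d ^ 2]. *)
Lemma dim_even_commutant : exists K : {vspace 'M[R]_d},
  (forall T, T \in K <-> forall i j, T *m (A i *m A j) = A i *m A j *m T) /\
  exists k a b : nat, [/\ (k < 8)%N, (r + 8 * a = s + k + 8 * b)%N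
    & \dim K = nth 0%N [:: 2; 4; 8; 4; 8; 4; 2; 1]%N k].
Proof.
have us := enum_uniq 'I_(r + s); have mem_e i : i \in enum 'I_(r + s) by rewrite mem_enum.
have [K [KE dK]] := even_commutant cA us (mem_e (Ordinal n0)).
exists K; split=> [T|].
  by rewrite KE; split=> h i j; [apply: h|move=> _ _; apply: h].
have s0 : enum 'I_(r + s) != [::] by rewrite -size_eq0 size_enum_ord -lt0n.
have FS := frobenius_schur d0 cA irr.
rewrite (sum_tr_word_sqr cA us s0) (tr_word_sqr cA us) sum_word_sign map_gen_sign in FS.
have := sqr_tr_volume cA us irr; rewrite map_gen_sign.
have [k [a [b [m [k8 rs m0 mk [zE signE]]]]]] := gauss_prod_signature R r s.
rewrite zE in FS; rewrite signE => trW.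
exists k, a, b; split => //.
have pk : odd (size (enum 'I_(r + s))) = odd k by rewrite size_enum_ord; lia.
have {dK} dK : (\dim K)%:R * (m ^+ 2 * 2 ^+ k) = 2 * d%:R ^+ 2 :> R.
  move/(congr1 (fun x => x%:R : R)): dK; rewrite natrM !natrX size_enum_ord => <-.
  by rewrite mk mulrCA -exprS prednK.
rewrite pk in trW FS; rewrite size_enum_ord exprS -mk {pk} in FS.
apply/eqP; rewrite -(eqr_nat R); apply/eqP.
have D0 : 0 < d%:R :> R by rewrite ltr0n.
move: (d%:R : R) D0 dK FS trW => D D0 dK FS trW.
have m2 : m ^+ 2 != 0 by rewrite expf_neq0 // gt_eqF.
have fin (x y c : R) : D = c * m -> (\dim K)%:R * (m ^+ 2 * x) = 2 * D ^+ 2 ->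
    2 * c ^+ 2 = y * x -> x != 0 -> (\dim K)%:R = y.
  move=> -> e cy x0; apply: (mulIf (mulf_neq0 m2 x0)); rewrite e.
  by transitivity (2 * c ^+ 2 * m ^+ 2); [ring|rewrite cy; ring].
(* In each case the quadratic polynomial in [D] splits as
   [(D - x m) (D + y m)], and [fin] compares [2 D ^ 2] with [2 ^ n]. *)
have quad (x y : R) : 0 < y -> (D - x * m) * (D + y * m) = 0 -> D = x * m.
  move=> y0 /eqP; rewrite mulf_eq0 subr_eq0 => /orP[/eqP//|].
  by rewrite gt_eqF // addr_gt0 // mulr_gt0.
clear rs zE signE mk; move: k8 dK FS trW.
case: k => [|[|[|[|[|[|[|[|//]]]]]]]] _ dK FS /= trW; rewrite /= ?trW // in FS.
- by apply: (fin _ 2 1 _ dK); [apply: (quad _ 2) => //; lra|lra|lra].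
- by apply: (fin _ 4 2 _ dK); [apply: (quad _ 2) => //; lra|lra|lra].
- by apply: (fin _ 8 4 _ dK); [apply: (quad _ 2) => //; lra|lra|lra].
- by apply: (fin _ 4 4 _ dK); [apply: (quad _ 2) => //; lra|lra|lra].
- by apply: (fin _ 8 8 _ dK); [apply: (quad _ 4) => //; lra|lra|lra].
- by apply: (fin _ 4 8 _ dK); [apply: (quad _ 8) => //; lra|lra|lra].
- by apply: (fin _ 2 8 _ dK); [apply: (quad _ 16) => //; lra|lra|lra].
- by apply: (fin _ 1 8 _ dK); [apply: (quad _ 16) => //; lra|lra|lra].
Qed.

(** An invariant inner product [G] satisfies [A i G = q_i G (A i)^T] with [q_i]
    the square of [A i]. Multiplying [G] by the product of the generators with
    negative square removes the dependence of the sign on [i]. *)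
Lemma spin_form : exists H : 'M[R]_d, exists c : R,
  [/\ H \in unitmx, c * c = 1 & forall i, A i *m H = c *: (H *m (A i)^T)].
Proof.
have us := enum_uniq 'I_(r + s); have mem_e i : i \in enum 'I_(r + s) by rewrite mem_enum.
pose J := [seq i : 'I_(r + s) <- enum 'I_(r + s) | (i < r)%N].
have uJ : uniq J by rewrite filter_uniq.
have [sqA ac q1] := cA.
pose W := word A J.
exists (W *m gram A (enum 'I_(r + s))), ((-1) ^+ size J); split.
- rewrite unitmx_mul (posdef_unit (gram_posdef _ _)) andbT.
  have := word_sqr cA uJ (fun i _ => mem_e i).
  have e0 : word_sign (map gen_sign J) != 0.
    elim: (J) => [|i t IH] /=; rewrite ?oner_neq0 // !mulf_neq0 ?signr_eq0 //.
    by rewrite /gen_sign; case: ifP; rewrite ?oppr_eq0 oner_neq0.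
  move=> WW; have : W *m ((word_sign (map gen_sign J))^-1 *: W) = 1%:M.
    by rewrite -scalemxAr WW scale_scalar_mx mulVf.
  by case/mulmx1_unit.
- by rewrite -signr_odd; case: odd; rewrite ?mulrNN mulr1.
move=> i; rewrite mulmxA (word_comm (A := A) (j := i)); last first.
  by move=> k _ ki; apply: ac => //; rewrite eq_sym.
rewrite -scalemxAl -mulmxA (invariant_comm cA (mem_e i) (gram_inv cA (mem_e i))).
rewrite -scalemxAr scalerA mulmxA; congr (_ *: _).
have [ir|ir] := boolP (i < r)%N.
  have iJ : i \in J by rewrite mem_filter ir mem_e.
  by rewrite -(count_full iJ uJ) /gen_sign ir exprS mulrC.
rewrite /gen_sign (negPf ir) mulr1; congr (_ ^+ _).
apply/eqP; rewrite -all_count; apply/allP => k; rewrite mem_filter => /andP[kr _] /=.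
by apply: contraNneq ir => <-.
Qed.

End Signature.

(** * The Clifford algebra *)

Section Lfun.
Variable R : fieldType.

Lemma linfun_linear (aT rT : vectType R) (f : aT -> rT) :
  linear f -> linfun f =1 f.
Proof.
move=> lf; pose F : {linear aT -> rT} := HB.pack f (GRing.isLinear.Build _ _ _ _ f lf).
exact: (lfunE F).
Qed.

Lemma v2r_lfun (aT rT : vectType R) (f : 'Hom(aT, rT)) x :
  v2r (f x) = v2r x *m f2mx f.
Proof. by rewrite unlock /= r2vK. Qed.

Lemma f2mx_comp (aT bT rT : vectType R) (f : 'Hom(bT, rT)) (g : 'Hom(aT, bT)) :
  f2mx (f \o g)%VF = f2mx g *m f2mx f.
Proof.
apply/row_matrixP => i; rewrite row_mul !rowE -[delta_mx 0 i]r2vK.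
by rewrite -!v2r_lfun lfunE.
Qed.

Lemma f2mx_id (aT : vectType R) : f2mx (\1%VF : 'End(aT)) = 1%:M.
Proof.
apply/row_matrixP => i; rewrite !rowE -[delta_mx 0 i]r2vK -!v2r_lfun.
by rewrite lfunE mulmx1.
Qed.

Lemma f2mx_linear (aT rT : vectType R) : linear (@f2mx R aT rT).
Proof.
move=> a f g; apply/row_matrixP => i; rewrite !rowE mulmxDr -scalemxAr.
by rewrite -[delta_mx 0 i]r2vK -!v2r_lfun add_lfunE scale_lfunE linearP.
Qed.
HB.instance Definition _ (aT rT : vectType R) :=
  GRing.isLinear.Build R 'Hom(aT, rT) _ _ (@f2mx R aT rT) (@f2mx_linear aT rT).

End Lfun.

Section Clifford.
Variables (R : realType) (r s : nat).
Local Notation V := 'rV[R]_(r + s).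

Definition basis_vec (i : 'I_(r + s)) : V := delta_mx 0 i.

Lemma sprodC (v w : V) : sprod v w = sprod w v.
Proof. by apply: eq_bigr => i _; rewrite mulrAC. Qed.

Lemma sprodPr (v : V) : scalar (sprod v).
Proof.
move=> a x y; rewrite /sprod mulr_sumr -big_split; apply: eq_bigr => i _ /=.
by rewrite !mxE; ring.
Qed.
HB.instance Definition _ (v : V) :=
  GRing.isLinear.Build R V R *%R (sprod v) (sprodPr v).

Lemma sprod_basis_vecr (v : V) i : sprod v (basis_vec i) = - gen_sign R i * v 0 i.
Proof.
rewrite /sprod (bigD1 i) //= big1 => [|j ji]; last by rewrite mxE (negPf ji) mulr0.
by rewrite mxE !eqxx addr0 /gen_sign /=; case: ifP => _; ring.
Qed.

Lemma sprod_basis_vec i j : sprod (basis_vec i) (basis_vec j) = if i == j then - gen_sign R i else 0.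
Proof.
rewrite sprod_basis_vecr mxE eqxx /= eq_sym; case: eqVneq => [->|_]; first by rewrite mulr1.
by rewrite mulr0.
Qed.

Lemma gen_sign_sqr (i : 'I_(r + s)) : gen_sign R i * gen_sign R i = 1.
Proof. by rewrite /gen_sign; case: ifP => _; rewrite ?mulrNN mulr1. Qed.

Lemma gen_sign_cases (i : 'I_(r + s)) : gen_sign R i = 1 \/ gen_sign R i = -1.
Proof. by rewrite /gen_sign; case: ifP; [right|left]. Qed.

Lemma gen_sign_neq0 (i : 'I_(r + s)) : gen_sign R i != 0.
Proof. by rewrite /gen_sign; case: ifP; rewrite ?oppr_eq0 oner_neq0. Qed.

Lemma sprod_inj (v w : V) : (forall x, sprod v x = sprod w x) -> v = w.
Proof.
move=> h; apply/rowP => i; have := h (basis_vec i); rewrite !sprod_basis_vecr.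
by apply: mulfI; rewrite oppr_eq0 gen_sign_neq0.
Qed.

Lemma row_sum_basis_vec (v : V) : v = \sum_i v 0 i *: basis_vec i.
Proof. exact: row_sum_delta. Qed.

Variables (C : falgType R) (iota : 'Hom('rV[R]_(r + s), C)).
Hypothesis cl : is_clifford_map iota.

Lemma iota_sqr v : iota v * iota v = - (sprod v v)%:A.
Proof. by case: cl => _ ->. Qed.

Lemma iota_anticomm v w :
  iota v * iota w + iota w * iota v = (- (2 * sprod v w))%:A.
Proof.
have h : iota (v + w) * iota (v + w) - iota v * iota v - iota w * iota w =
    iota v * iota w + iota w * iota v.
  rewrite linearD /= mulrDl !mulrDr; move: (iota v * iota v) (iota w * iota w).
  move=> x y; rewrite [X in X - x]addrC -!addrA addrC !addrA.
  by rewrite [y + x + _ - x]addrAC addrK [y + _ - y]addrAC subrr add0r.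
rewrite -h !iota_sqr linearD /= (sprodC (v + w)) (sprodC (v + w)) !linearD /=.
rewrite (sprodC w v) -!scaleNr -!scalerDl; congr (_ *: _).
by rewrite /GRing.scale /=; ring.
Qed.

(** The anticommutator of [iota v] and [iota x] determines [sprod v x]. *)
Lemma iota_inj : lker iota == 0%VS.
Proof.
apply/lker0P => v w e; apply: sprod_inj => x.
have := iota_anticomm v x; rewrite e iota_anticomm => /eqP.
rewrite -subr_eq0 -scalerBl scaler_eq0 oner_eq0 orbF => /eqP h; lra.
Qed.

End Clifford.

Section Generation.
Variables (R : realType) (r s : nat).
Variables (C : falgType R) (iota : 'Hom('rV[R]_(r + s), C)).
Hypothesis cl : is_clifford_algebra iota.

(** The universal property gives an algebra morphism from [C] to [A]. Followed by
    the inclusion it fixes the generators, so by uniqueness it is the identity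
    of [C]. *)
Lemma clifford_generated (A : {aspace C}) : 1 \in A ->
  (forall v, iota v \in A) -> A = fullv :> {vspace C}.
Proof.
move=> A1 iA; case: cl => cm univ.
have a1 : algid A = 1 by apply/eqP; rewrite algid_eq1.
pose f (v : 'rV[R]_(r + s)) : subvs_of A := vsproj A (iota v).
have fcl : is_clifford_map f.
  split; first by move=> a v w; rewrite /f !linearP.
  by move=> v; apply: val_inj; rewrite /= a1 vsprojK ?iA // cm.2.
have [F [Fi _]] := univ _ _ fcl.
have [F0 [_ uF0]] := univ _ _ cm.
pose g (x : C) : C := vsval (F x).
have glin : linear g by move=> a x y; rewrite /g !linearP.
have gmul : monoid_morphism g.
  by split=> [|x y]; rewrite /g ?rmorph1 ?rmorphM //= a1.
pose G : {lrmorphism C -> C} := HB.pack g (GRing.isLinear.Build _ _ _ _ g glin)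
  (GRing.isMonoidMorphism.Build _ _ g gmul).
have G1 : G =1 F0 by apply: uF0 => v; rewrite /= /g Fi vsprojK.
have I1 : (idfun : {lrmorphism C -> C}) =1 F0 by apply: uF0.
apply/vspaceP => x; rewrite memvf -[x]/((idfun : {lrmorphism C -> C}) x) I1 -G1.
exact: subvsP.
Qed.

Variables (S : vectType R) (rho : 'Hom(C, 'End(S))).
Hypothesis irr : is_irreducible_module rho.

(** The elements that preserve [U] form a subspace closed under products, so it
    is enough that the generators belong to it. *)
Lemma irreducible_generators (U : {vspace S}) :
  (forall v, (rho (iota v) @: U <= U)%VS) -> U = 0%VS \/ U = fullv.
Proof.
move=> hU; have [[rho1 rhoM] _ simple] := irr; apply: simple => a.
(* [st c] vanishes exactly when [rho c] preserves [U]. *)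
pose st (c : C) : 'End(S) := ((\1 - projv U) \o rho c \o projv U)%VF.
have stl : linear st.
  move=> b x y; rewrite /st linearP /= comp_lfunDr comp_lfunDl -comp_lfunZr.
  by rewrite -comp_lfunZl.
pose A := lker (linfun st).
have AE c : c \in A -> (rho c @: U <= U)%VS.
  rewrite memv_ker (linfun_linear stl) => /eqP /lfunP h.
  apply/subvP => _ /memv_imgP[x Ux ->]; have := h x.
  rewrite !comp_lfunE (projv_id Ux) add_lfunE opp_lfunE id_lfunE zero_lfunE.
  move/eqP.
  by rewrite subr_eq0 => /eqP ->; apply: memv_proj.
have EA c : (rho c @: U <= U)%VS -> c \in A.
  move=> /subvP h; rewrite memv_ker (linfun_linear stl); apply/eqP/lfunP => x.
  rewrite !comp_lfunE add_lfunE opp_lfunE id_lfunE zero_lfunE.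
  rewrite [projv U (rho c _)]projv_id ?subrr //.
  by apply: h; rewrite memv_img ?memv_proj.
have gA : (agenv (limg iota) <= A)%VS.
  apply: agenv_sub_modl.
    by rewrite -memvE EA // rho1 lim1g.
  apply/prodvP => _ c /memv_imgP[v _ ->] /AE Ac; apply: EA.
  by rewrite rhoM limg_comp (subv_trans (limgS _ Ac)).
apply: AE; apply: (subvP gA); rewrite agenvE (clifford_generated (A := agenv_aspace (limg iota))) ?memvf //.
  by rewrite memvE sub1_agenv.
by move=> v; apply: (subvP (sub_agenv _)); rewrite memv_img ?memvf.
Qed.

End Generation.

(** * Conjugation by the spin group *)

Section SpinGroup.
Variables (R : realType) (r s : nat).
Local Notation V := 'rV[R]_(r + s).
Variables (C : falgType R) (iota : 'Hom('rV[R]_(r + s), C)).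
Hypothesis cl : is_clifford_map iota.

Lemma iota_basis_vec_sqr i : iota (basis_vec R i) * iota (basis_vec R i) = (gen_sign R i)%:A.
Proof. by rewrite (iota_sqr cl) sprod_basis_vec eqxx scaleNr opprK. Qed.

Lemma iota_basis_vec_anticomm i j : i != j ->
  iota (basis_vec R i) * iota (basis_vec R j) = - (iota (basis_vec R j) * iota (basis_vec R i)).
Proof.
move=> ij; apply/eqP; rewrite -addr_eq0 (iota_anticomm cl) sprod_basis_vec (negPf ij).
by rewrite mulr0 oppr0 scale0r.
Qed.

Definition unit_vector (v : V) := sprod v v = 1 \/ sprod v v = -1.

Lemma unit_vector_sqr v : unit_vector v -> sprod v v * sprod v v = 1.
Proof. by case=> ->; rewrite ?mulrNN mulr1. Qed.

Lemma iota_unit_inv v : unit_vector v ->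
  iota v \is a GRing.unit /\ (iota v)^-1 = iota (- sprod v v *: v).
Proof.
move=> uv; have e1 : iota (- sprod v v *: v) * iota v = 1.
  rewrite linearZ /= -scalerAl (iota_sqr cl) -scaleNr scalerA mulrNN.
  by rewrite unit_vector_sqr // scale1r.
have e2 : iota v * iota (- sprod v v *: v) = 1.
  rewrite linearZ /= -scalerAr (iota_sqr cl) -scaleNr scalerA mulrNN.
  by rewrite unit_vector_sqr // scale1r.
have u : iota v \is a GRing.unit by apply/unitrP; exists (iota (- sprod v v *: v)).
by split=> //; apply: (mulrI u); rewrite mulrV.
Qed.

Lemma unit_vector_inv v : unit_vector v -> unit_vector (- sprod v v *: v).
Proof.
move=> uv; rewrite /unit_vector linearZ /= sprodC linearZ /= mulrA mulrNN.
by rewrite unit_vector_sqr // mul1r.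
Qed.

Definition vector_product (vs : seq V) := \prod_(v <- vs) iota v.

Lemma vector_product_unit vs : (forall v, v \in vs -> unit_vector v) ->
  vector_product vs \is a GRing.unit.
Proof.
move=> uvs; rewrite /vector_product big_seq; apply: rpred_prod => v /uvs uv.
by case: (iota_unit_inv uv).
Qed.

Lemma spin_groupV g : spin_group iota g -> spin_group iota g^-1.
Proof.
case=> vs [evs uvs ->]; exists (rev (map (fun v => - sprod v v *: v) vs)); split.
- by rewrite size_rev size_map.
- by move=> v; rewrite mem_rev => /mapP[w /uvs uw ->]; apply: unit_vector_inv.
elim: vs {evs} uvs => [|v vs IH] uvs /=; first by rewrite !big_nil invr1.
have uw : forall w, w \in vs -> unit_vector w by move=> w h; apply: uvs; rewrite inE h orbT.
have [ui ie] := iota_unit_inv (uvs v (mem_head _ _)).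
rewrite big_cons invrM ?vector_product_unit // IH // rev_cons -cats1 big_cat /=.
by rewrite big_seq1 ie.
Qed.

(** Up to sign, conjugation by a unit vector is a reflection. *)
Lemma conj_unit_vector u w : unit_vector u -> exists x, iota u * iota w * (iota u)^-1 = iota x.
Proof.
move=> uu; have [ui ie] := iota_unit_inv uu.
have -> : iota u * iota w = (- (2 * sprod u w))%:A - iota w * iota u.
  by rewrite -(iota_anticomm cl) addrK.
exists (- (2 * sprod u w) *: (- sprod u u *: u) - w).
by rewrite mulrBl mulrK // ie -scalerAl mul1r linearB /= [in RHS]linearZ.
Qed.

Lemma iota_vector_rep g v : spin_group iota g ->
  iota (vector_rep iota g v) = g * iota v * g^-1.
Proof.
case=> vs [_ uvs ->].
suff [x xE] : exists x, \prod_(v <- vs) iota v * iota v * (\prod_(v <- vs) iota v)^-1 = iota x.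
  by rewrite /vector_rep xE (lker0_lfunK (iota_inj cl)).
elim: vs uvs => [|u vs IH] uvs; first by exists v; rewrite big_nil invr1 mulr1 mul1r.
have uw : forall w, w \in vs -> unit_vector w by move=> w h; apply: uvs; rewrite inE h orbT.
have uu := uvs u (mem_head _ _); have [ui _] := iota_unit_inv uu.
have [x xE] := IH uw; have [y yE] := conj_unit_vector x uu; exists y.
rewrite big_cons invrM // ?vector_product_unit // !mulrA -yE -xE !mulrA.
by [].
Qed.

Lemma spin_group_unit g : spin_group iota g -> g \is a GRing.unit.
Proof. by case=> vs [_ uvs ->]; apply: vector_product_unit. Qed.

Lemma iota_injP v w : iota v = iota w -> v = w.
Proof. by move/lker0P: (iota_inj cl); apply. Qed.

Lemma vector_repK g : spin_group iota g ->
  cancel (vector_rep iota g) (vector_rep iota g^-1).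
Proof.
move=> sg v; apply: iota_injP; have gu := spin_group_unit sg.
rewrite (iota_vector_rep _ (spin_groupV sg)) (iota_vector_rep _ sg) invrK.
by rewrite !mulrA mulVr // mul1r mulrVK.
Qed.

Lemma sprod_vector_rep g v w : spin_group iota g ->
  sprod (vector_rep iota g v) (vector_rep iota g w) = sprod v w.
Proof.
move=> sg; have gu := spin_group_unit sg.
have h : iota (vector_rep iota g v) * iota (vector_rep iota g w) +
   iota (vector_rep iota g w) * iota (vector_rep iota g v) =
   g * (iota v * iota w + iota w * iota v) * g^-1.
  by rewrite !iota_vector_rep // mulrDr mulrDl !mulrA !mulrVK.
move: h; rewrite !(iota_anticomm cl) -scalerAr -scalerAl mulr1 mulrV // => /eqP.
rewrite -subr_eq0 -scalerBl scaler_eq0 oner_eq0 orbF => /eqP h; lra.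
Qed.

End SpinGroup.

Section Rotation.
Variables (R : realType) (r s : nat).
Variables (C : falgType R) (iota : 'Hom('rV[R]_(r + s), C)).
Hypothesis cl : is_clifford_map iota.
Variables (i j : 'I_(r + s)).
Hypothesis ij : i != j.

Definition bivector := iota (basis_vec R i) * iota (basis_vec R j).
Local Notation u := bivector.
Definition bivector_sign : R := - (gen_sign R i * gen_sign R j).
Local Notation e := bivector_sign.

Lemma bivector_sign_cases : e = 1 \/ e = -1.
Proof.
rewrite /bivector_sign.
by case: (gen_sign_cases R i) => ->; case: (gen_sign_cases R j) => ->;
  rewrite ?mulr1 ?mulrN1 ?opprK; [right|left|left|right].
Qed.

Lemma bivector_sqr : u * u = e%:A.
Proof.
rewrite /bivector mulrA -[_ * _ * iota (basis_vec R i)]mulrA (iota_basis_vec_anticomm cl (i := j)).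
  rewrite mulrN mulNr mulrA (iota_basis_vec_sqr cl) -scalerAl mul1r -scalerAl.
  by rewrite (iota_basis_vec_sqr cl) scalerA -scaleNr.
by rewrite eq_sym.
Qed.

(** Up to sign, the exponentials of multiples of [e_i e_j] are the elements
    [a + b e_i e_j] with [a ^ 2 - e b ^ 2 = 1], where [e] is the square of
    [e_i e_j]: circular for [e = -1], hyperbolic for [e = 1]. *)
Definition rotor (a b : R) : C := a%:A + b *: u.

Lemma rotor_mul a b a' b' :
  rotor a b * rotor a' b' = rotor (a * a' + e * (b * b')) (a * b' + b * a').
Proof.
rewrite /rotor mulrDl !mulrDr -!scalerAl -!scalerAr !mul1r !mulr1 bivector_sqr.
rewrite !scalerA [X in _ + X]addrC addrACA -!scalerDl.
by congr (_ *: _ + _ *: _); rewrite /GRing.scale /=; ring.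
Qed.

(** [a + b e_i e_j] is the product of [e_i] and [e_i^-1 a + b e_j], which has the
    same square as [e_i]. *)
Lemma rotor_spin a b : a ^+ 2 - e * b ^+ 2 = 1 -> spin_group iota (rotor a b).
Proof.
move=> ab; exists [:: basis_vec R i; (gen_sign R i * a) *: basis_vec R i + b *: basis_vec R j]; split=> //.
  have n k : unit_vector (basis_vec R k : 'rV[R]_(r + s)).
    rewrite /unit_vector sprod_basis_vec eqxx /gen_sign; case: ifP => _; last by right.
    by left; rewrite opprK.
  move=> v; rewrite !inE => /orP[] /eqP ->; first exact: n.
  rewrite /unit_vector.
  have -> : sprod ((gen_sign R i * a) *: basis_vec R i + b *: basis_vec R j)
                  ((gen_sign R i * a) *: basis_vec R i + b *: basis_vec R j) = - gen_sign R i.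
    rewrite linearD /= !linearZ /= !(sprodC (_ + _)) !linearD /= !linearZ /=.
    rewrite !sprod_basis_vec !eqxx (negPf ij) eq_sym (negPf ij).
    rewrite -[RHS]mulr1 -ab /e; have := gen_sign_sqr R i; have := gen_sign_sqr R j.
    move: (gen_sign R i) (gen_sign R j) => x y yy xx; ring: xx yy.
  by have := n i; rewrite /unit_vector sprod_basis_vec eqxx.
rewrite big_cons big_seq1 linearD /= !linearZ /= mulrDr -!scalerAr (iota_basis_vec_sqr cl).
by rewrite scalerA mulrAC gen_sign_sqr mul1r.
Qed.

Lemma rotor_inv a b : a ^+ 2 - e * b ^+ 2 = 1 -> (rotor a b)^-1 = rotor a (- b).
Proof.
move=> ab; have sg := rotor_spin ab; apply: (mulrI (spin_group_unit cl sg)).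
rewrite mulrV ?(spin_group_unit cl sg) // rotor_mul.
have -> : a * a + e * (b * - b) = 1 by rewrite -ab; ring.
have -> : a * - b + b * a = 0 by ring.
by rewrite /rotor scale0r addr0 scale1r.
Qed.

Lemma bivector_basis_veci : u * iota (basis_vec R i) = - gen_sign R i *: iota (basis_vec R j).
Proof.
rewrite /bivector -mulrA (iota_basis_vec_anticomm cl (i := j)) 1?eq_sym //.
by rewrite mulrN mulrA (iota_basis_vec_sqr cl) -scalerAl mul1r scaleNr.
Qed.

Lemma bivector_basis_vecj : u * iota (basis_vec R j) = gen_sign R j *: iota (basis_vec R i).
Proof. by rewrite /bivector -mulrA (iota_basis_vec_sqr cl) -scalerAr mulr1. Qed.

(** If [e_k] anticommutes with [e_i e_j], then [g e_k g^-1 = g g e_k]. *)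
Lemma rotor_rep_anti a b k : a ^+ 2 - e * b ^+ 2 = 1 ->
  iota (basis_vec R k) * u = - (u * iota (basis_vec R k)) ->
  iota (vector_rep iota (rotor a b) (basis_vec R k)) =
  (a ^+ 2 + e * b ^+ 2) *: iota (basis_vec R k) + (2 * (a * b)) *: (u * iota (basis_vec R k)).
Proof.
move=> ab ku; rewrite (iota_vector_rep cl _ (rotor_spin ab)) rotor_inv //.
have h : iota (basis_vec R k) * rotor a (- b) = rotor a b * iota (basis_vec R k).
  rewrite /rotor mulrDr mulrDl -!scalerAr -!scalerAl ku mulr1 mul1r.
  by rewrite scalerN scaleNr opprK.
rewrite -mulrA h mulrA rotor_mul /rotor mulrDl -!scalerAl mul1r.
by congr (_ *: _ + _ *: _); ring.
Qed.

Lemma rotor_rep_i a b : a ^+ 2 - e * b ^+ 2 = 1 ->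
  vector_rep iota (rotor a b) (basis_vec R i) =
  (a ^+ 2 + e * b ^+ 2) *: basis_vec R i - (2 * (a * b) * gen_sign R i) *: basis_vec R j.
Proof.
move=> ab; apply: (iota_injP cl); rewrite rotor_rep_anti // ?bivector_basis_veci.
  by rewrite linearB /= !linearZ /= scalerA (mulNr (gen_sign R i)) scaleNr scalerN [gen_sign R i * _]mulrC.
by rewrite /bivector mulrA (iota_basis_vec_sqr cl) -scalerAl mul1r scaleNr opprK.
Qed.

Lemma rotor_rep_j a b : a ^+ 2 - e * b ^+ 2 = 1 ->
  vector_rep iota (rotor a b) (basis_vec R j) =
  (a ^+ 2 + e * b ^+ 2) *: basis_vec R j + (2 * (a * b) * gen_sign R j) *: basis_vec R i.
Proof.
move=> ab; apply: (iota_injP cl); rewrite rotor_rep_anti // ?bivector_basis_vecj.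
  by rewrite linearD /= !linearZ /= scalerA [gen_sign R j * _]mulrC.
rewrite /bivector mulrA (iota_basis_vec_anticomm cl (i := j)) 1?eq_sym //.
by rewrite mulNr -mulrA (iota_basis_vec_sqr cl) -scalerAr mulr1.
Qed.

Lemma rotor_rep_k a b k : a ^+ 2 - e * b ^+ 2 = 1 -> k != i -> k != j ->
  vector_rep iota (rotor a b) (basis_vec R k) = basis_vec R k.
Proof.
move=> ab ki kj; apply: (iota_injP cl); rewrite (iota_vector_rep cl _ (rotor_spin ab)).
suff -> : rotor a b * iota (basis_vec R k) = iota (basis_vec R k) * rotor a b.
  by rewrite mulrK // (spin_group_unit cl (rotor_spin ab)).
rewrite /rotor mulrDr mulrDl -!scalerAr -!scalerAl mulr1 mul1r; congr (_ + _ *: _).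
rewrite /bivector -[_ * _ * iota (basis_vec R k)]mulrA.
rewrite (iota_basis_vec_anticomm cl (i := j)) 1?eq_sym // mulrN mulrA.
by rewrite (iota_basis_vec_anticomm cl (i := i) (j := k)) 1?eq_sym // mulNr opprK -mulrA.
Qed.

End Rotation.

(** * Paths in the spin group *)

Section Topology.
Local Open Scope classical_set_scope.
Local Open Scope ring_scope.
Variable R : realType.

Lemma continuous_sum (T : topologicalType) (I : Type) (l : seq I) (F : I -> T -> R) :
  (forall i, continuous (F i)) -> continuous (fun x => \sum_(i <- l) F i x).
Proof.
move=> cF; elim: l => [|i l IH].
  rewrite (_ : (fun _ => _) = cst 0); last by apply/funext => x; rewrite big_nil.
  exact: cst_continuous.
rewrite (_ : (fun _ => _) = F i \+ (fun x => \sum_(k <- l) F k x)); last first.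
  by apply/funext => x; rewrite big_cons.
by move=> x; apply: cvgD; [apply: cF|apply: IH].
Qed.

Variables (r s : nat) (C : falgType R) (iota : 'Hom('rV[R]_(r + s), C)).
Hypothesis cl : is_clifford_map iota.

Lemma coords_linear : linear (@coords R C).
Proof. by move=> a x y; apply/rowP => i; rewrite !mxE linearP. Qed.
HB.instance Definition _ :=
  GRing.isLinear.Build R C 'rV[R]_(\dim {:C}) _ (@coords R C) coords_linear.

Lemma coordsK (x : C) : x = \sum_i coords x 0 i *: (vbasis {:C})`_i.
Proof. by rewrite {1}(coord_vbasis (memvf x)); apply: eq_bigr => i _; rewrite mxE. Qed.

(** The rational parametrization of the conic [a ^ 2 - e b ^ 2 = 1] is a path in
    the spin group that passes through 1 at [t = 0]. It has no pole on the
    interval, also when the conic is a hyperbola. *)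
Lemma rotor_spin0 (i j : 'I_(r + s)) (t : R) : i != j -> -(1/2) <= t <= 1/2 ->
  let e := bivector_sign R i j in
  spin0 iota (rotor iota i j ((1 + e * t ^+ 2) / (1 - e * t ^+ 2))
                             (2 * t / (1 - e * t ^+ 2))).
Proof.
move=> ij t2 e.
have e1 : e = 1 \/ e = -1 := bivector_sign_cases R i j.
pose den (x : R) := 1 - e * x ^+ 2.
have den0 x : -(1/2) <= x <= 1/2 -> den x != 0.
  move=> x2; have : x ^+ 2 <= 1 / 4 by nra.
  have : 0 <= x ^+ 2 by apply: sqr_ge0.
  by rewrite /den => h1 h2; case: e1 => ->; apply/eqP; lra.
pose a x := (1 + e * x ^+ 2) / den x; pose b x := 2 * x / den x.
have ab x : -(1/2) <= x <= 1/2 -> a x ^+ 2 - e * b x ^+ 2 = 1.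
  by move=> /den0 d0; rewrite /a /b; move: (d0); rewrite /den => d1; field.
pose p x := coords (rotor iota i j (a x) (b x)).
have pE x : p x = a x *: coords 1 + b x *: coords (bivector iota i j).
  by rewrite /p /rotor linearD !linearZ.
have sg x : -(1/2) <= x <= 1/2 -> spin_group iota (rotor iota i j (a x) (b x)).
  by move=> /ab; apply: rotor_spin.
split; first exact: sg.
exists (p @` `[-(1/2), 1/2]); last by exists t => //=; rewrite in_itv.
split.
- exists 0; first by rewrite /= in_itv /=; apply/andP; split; lra.
  by rewrite pE /a /b /den expr0n /= !mulr0 mul0r subr0 addr0 divr1 scale1r scale0r addr0.
- move=> y [x xI <-]; move: xI; rewrite /= in_itv /= => x2; exists (rotor iota i j (a x) (b x)) => //.
  exact: sg.
apply: connected_continuous_connected; first exact: segment_connected.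
apply: continuous_in_subspaceT => x; rewrite inE /= in_itv /= => /den0 d0.
have cden : den y @[y --> x] --> den x.
  by rewrite /den; apply: cvgB; [exact: cvg_cst|apply: cvgM; [exact: cvg_cst|apply: exprn_continuous]].
have ca : a y @[y --> x] --> a x.
  apply: cvgM; last exact: cvgV.
  by apply: cvgD; [exact: cvg_cst|apply: cvgM; [exact: cvg_cst|apply: exprn_continuous]].
have cb : b y @[y --> x] --> b x.
  apply: cvgM; last exact: cvgV.
  by apply: cvgM; [exact: cvg_cst|exact: cvg_id].
rewrite (_ : p = fun x => a x *: coords 1 + b x *: coords (bivector iota i j)); last first.
  by apply/funext.
by apply: cvgD; apply: cvgZr_tmp.
Qed.

End Topology.

(** * The spin-invariant form on the module *)

Section Rep.
Local Open Scope classical_set_scope.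
Local Open Scope ring_scope.
Variable R : realType.
Variables (r s : nat) (C : falgType R) (iota : 'Hom('rV[R]_(r + s), C)).
Hypothesis cl : is_clifford_map iota.
Variables (S : vectType R) (rho : 'Hom(C, 'End(S))).
Hypothesis mod : is_module rho.
Local Notation d := (dim S).

Definition rho_mx (x : C) : 'M[R]_(dim S) := f2mx (rho x).

Lemma rho_mx_linear : linear rho_mx.
Proof. by move=> a x y; rewrite /rho_mx !linearP. Qed.
HB.instance Definition _ := GRing.isLinear.Build R C _ _ rho_mx rho_mx_linear.

Lemma rho_mx1 : rho_mx 1 = 1%:M.
Proof. by rewrite /rho_mx mod.1 f2mx_id. Qed.

Lemma rho_mxM x y : rho_mx (x * y) = rho_mx y *m rho_mx x.
Proof. by rewrite /rho_mx mod.2 f2mx_comp. Qed.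

Lemma v2r_rho x (y : S) : v2r (rho x y) = v2r y *m rho_mx x.
Proof. exact: v2r_lfun. Qed.

Definition gamma v := rho_mx (iota v).

Lemma gamma_linear : linear gamma.
Proof. by move=> a x y; rewrite /gamma !linearP. Qed.
HB.instance Definition _ := GRing.isLinear.Build R _ _ _ gamma gamma_linear.

Lemma gamma_sqr v : gamma v *m gamma v = (- sprod v v)%:M.
Proof. by rewrite -rho_mxM (iota_sqr cl) linearN linearZ /= rho_mx1 -scaleNr scalemx1. Qed.

Lemma gamma_clifford_system :
  clifford_system (fun i => gamma (basis_vec R i)) (@gen_sign R r s) (enum 'I_(r + s)).
Proof.
split=> [i _|i j _ _ ij|i _]; last exact: gen_sign_sqr.
  by rewrite gamma_sqr sprod_basis_vec eqxx opprK.
by rewrite -!rho_mxM (iota_basis_vec_anticomm cl) 1?eq_sym // linearN.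
Qed.

Lemma gamma_sum v : gamma v = \sum_i v 0 i *: gamma (basis_vec R i).
Proof. by rewrite {1}(row_sum_basis_vec v) linear_sum; apply: eq_bigr => i _; rewrite linearZ. Qed.

Variables (H : 'M[R]_d) (c : R).
Hypotheses (uH : H \in unitmx) (cc : c * c = 1).
Hypothesis HE : forall i, gamma (basis_vec R i) *m H = c *: (H *m (gamma (basis_vec R i))^T).

Lemma form_gamma v : gamma v *m H = c *: (H *m (gamma v)^T).
Proof.
rewrite gamma_sum mulmx_suml linear_sum /= mulmx_sumr scaler_sumr.
apply: eq_bigr => i _; rewrite -scalemxAl HE [in RHS]linearZ /= -scalemxAr.
by rewrite !scalerA mulrC.
Qed.

(** A unit vector multiplies the form by a sign. *)
Lemma form_spin_group g : spin_group iota g ->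
  exists2 e : R, e = 1 \/ e = -1 & rho_mx g *m H *m (rho_mx g)^T = e *: H.
Proof.
case=> vs [_ uvs ->]; elim: vs uvs => [|v vs IH] uvs.
  by exists 1; [left|rewrite big_nil rho_mx1 trmx1 mul1mx mulmx1 scale1r].
have [w wvs|e e1 eE] := IH; first by apply: uvs; rewrite inE wvs orbT.
exists (- (c * sprod v v) * e).
  have c1 : c = 1 \/ c = -1.
    by move/eqP: cc; rewrite -expr2 sqrf_eq1 => /orP[] /eqP; [left|right].
  have : sprod v v = 1 \/ sprod v v = -1 by apply: uvs; rewrite mem_head.
  by case: c1 => ->; case: e1 => -> [] ->; rewrite ?(mulr1, mulrN1, mul1r, opprK); tauto.
have vE : gamma v *m H *m (gamma v)^T = - (c * sprod v v) *: H.
  have hE : H *m (gamma v)^T = c *: (gamma v *m H) by rewrite form_gamma scalerA cc scale1r.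
  rewrite -mulmxA hE -scalemxAr mulmxA gamma_sqr mul_scalar_mx scalerA.
  by congr (_ *: _); ring.
rewrite big_cons rho_mxM -/(gamma v); set M := rho_mx _ in eE *.
rewrite trmx_mul mulmxA -(mulmxA M) -(mulmxA M) vE -scalemxAr -scalemxAl eE.
by rewrite scalerA.
Qed.

(** Along a connected set that contains 1 the sign is continuous. Concretely, a
    nonzero entry [H i j] of the form becomes a continuous function with values
    [H i j] and [- H i j], and its image is an interval. *)
Lemma form_spin0 g : (0 < d)%N -> spin0 iota g -> rho_mx g *m H *m (rho_mx g)^T = H.
Proof.
move=> d0 [sg [B [B1 BI cB] Bg]].
have [e [->|e1] gE] := form_spin_group sg; first by rewrite gE scale1r.
rewrite e1 scaleN1r in gE; exfalso.
have [i [j Hij]] : exists i j, H i j != 0.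
  apply/matrix0Pn; apply: contraTneq uH => ->.
  by rewrite -row_free_unit /row_free mxrank0 eq_sym -lt0n d0.
pose M (x : 'rV[R]_(\dim {:C})) := \sum_k x 0 k *: rho_mx (vbasis {:C})`_k.
have MC x : M (coords x) = rho_mx x.
  by rewrite [in RHS](coordsK x) linear_sum; apply: eq_bigr => k _; rewrite linearZ.
pose f x := (M x *m H *m (M x)^T) i j.
have fE x : f x = \sum_k \sum_l x 0 k * x 0 l *
    (rho_mx (vbasis {:C})`_k *m H *m (rho_mx (vbasis {:C})`_l)^T) i j.
  rewrite /f /M !mulmx_suml summxE; apply: eq_bigr => k _.
  rewrite linear_sum /= mulmx_sumr summxE; apply: eq_bigr => l _.
  by rewrite linearZ /= -scalemxAr -!scalemxAl !mxE; ring.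
have cf : continuous f.
  rewrite (_ : f = fun x => \sum_k \sum_l x 0 k * x 0 l *
    (rho_mx (vbasis {:C})`_k *m H *m (rho_mx (vbasis {:C})`_l)^T) i j); last exact/funext.
  apply: continuous_sum => k; apply: continuous_sum => l x.
  have ck m : (y : 'rV[R]_(\dim {:C})) 0 m @[y --> x] --> x 0 m.
    exact: coord_continuous.
  exact: (cvgM (cvgM (ck k) (ck l)) (cvg_cst _)).
have : connected (f @` B).
  apply: connected_continuous_connected => //.
  exact: continuous_subspaceT.
move/connected_intervalP => iB.
have f1 : (f @` B) (H i j).
  by exists (coords 1) => //; rewrite /f MC rho_mx1 trmx1 mul1mx mulmx1.
have fg : (f @` B) (- H i j).
  by exists (coords g) => //; rewrite /f MC gE mxE.
have [b Bb fb] : (f @` B) 0.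
  have [Hp|Hn] := leP 0 (H i j); [apply: (iB _ _ fg f1) | apply: (iB _ _ f1 fg)];
  by rewrite ?oppr_le0 ?oppr_ge0 ?Hp ?(ltW Hn).
have [g' sg' gb] := BI _ Bb; move: fb; rewrite -gb /f MC => fb.
have [e' e1' h] := form_spin_group sg'; move: fb; rewrite h mxE => /eqP.
by case: e1' => ->; rewrite ?mul1r ?mulN1r ?oppr_eq0 (negPf Hij).
Qed.

End Rep.

(** * Irreducibility of the generators, and invariant trilinear forms *)

Section Irr.
Variable R : realType.
Variables (r s : nat) (C : falgType R) (iota : 'Hom('rV[R]_(r + s), C)).
Hypothesis cl : is_clifford_algebra iota.
Variables (S : vectType R) (rho : 'Hom(C, 'End(S))).
Hypothesis irr : is_irreducible_module rho.

Lemma module_dim_gt0 : (0 < dim S)%N.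
Proof.
case: irr => _ S0 _; rewrite lt0n; apply: contra S0.
by rewrite -dimv_eq0 dimvf.
Qed.

Lemma gamma_irreducible : mx_irreducible (fun i => gamma iota rho (basis_vec R i)) (enum 'I_(r + s)).
Proof.
move=> U stU U0; pose W := mx2vs U.
have WE (x : S) : (x \in W) = (v2r x <= U)%MS by rewrite memvE /subsetv !genmxE.
have stW v : (rho (iota v) @: W <= W)%VS.
  apply/subvP => y /memv_imgP[x xW ->]; have xU : (v2r x <= U)%MS by rewrite -WE.
  rewrite WE v2r_rho.
  apply: submx_trans (submxMr _ xU) _; rewrite -/(gamma _ _ _) gamma_sum mulmx_sumr.
  apply: summx_sub => i _; rewrite -scalemxAr scalemx_sub //.
  by apply: stU; rewrite mem_enum.
have [W0|W1] := irreducible_generators cl irr stW.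
  case/eqP: U0; apply/row_matrixP => i; rewrite row0.
  have : r2v (row i U) \in W by rewrite WE r2vK row_sub.
  by rewrite W0 memv0 => /eqP /(congr1 v2r); rewrite r2vK linear0.
rewrite -sub1mx; apply/row_subP => i.
by rewrite -[row i _]r2vK -WE W1 memvf.
Qed.

End Irr.

Section Rotors.
Variable R : realType.
Variables (r s : nat) (C : falgType R) (iota : 'Hom('rV[R]_(r + s), C)).
Hypothesis cl : is_clifford_map iota.

(** The points [t = 1/2] and [t = -1/2] of the path [rotor_spin0]. The rotor has
    rational coefficients and infinite order. *)
Lemma rotor_pair (i j : 'I_(r + s)) : i != j -> exists a b : R,
  [/\ (bivector_sign R i j, a, b) = (1, 5/3, 4/3) \/ (bivector_sign R i j, a, b) = (-1, 3/5, 4/5),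
      a ^+ 2 - bivector_sign R i j * b ^+ 2 = 1,
      a ^+ 2 - bivector_sign R i j * (- b) ^+ 2 = 1,
      spin0 iota (rotor iota i j a b)
    & spin0 iota (rotor iota i j a (- b))].
Proof.
move=> ij.
set e := bivector_sign R i j.
have key (t a b : R) : -(1/2) <= t <= 1/2 -> 1 - e * t ^+ 2 != 0 ->
    a * (1 - e * t ^+ 2) = 1 + e * t ^+ 2 -> b * (1 - e * t ^+ 2) = 2 * t ->
    spin0 iota (rotor iota i j a b).
  by move=> tI d0 ha hb; have := rotor_spin0 cl ij tI; rewrite /= -/e -ha -hb !mulfK.
have : e = 1 \/ e = -1 := bivector_sign_cases R i j.
case=> e1; rewrite e1 in key *.
  exists (5/3), (4/3); split; [by left|by field|by field| |].
    by apply: (key (1/2)); [lra|apply/eqP; lra|lra|lra].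
  by apply: (key (-(1/2))); [lra|apply/eqP; lra|lra|lra].
exists (3/5), (4/5); split; [by right|by field|by field| |].
  by apply: (key (1/2)); [lra|apply/eqP; lra|lra|lra].
by apply: (key (-(1/2))); [lra|apply/eqP; lra|lra|lra].
Qed.

Section Trilinear.
Local Notation V := 'rV[R]_(r + s).
Variable m : V -> V -> V -> R.
Hypothesis m1 : forall a b x x' y z, m (a *: x + b *: x') y z = a * m x y z + b * m x' y z.
Hypothesis m2 : forall a b x y y' z, m x (a *: y + b *: y') z = a * m x y z + b * m x y' z.
Hypothesis m3 : forall a b x y z z', m x y (a *: z + b *: z') = a * m x y z + b * m x y z'.
Hypothesis mg : forall g, spin0 iota g -> forall x y z,
  m (vector_rep iota g x) (vector_rep iota g y) (vector_rep iota g z) = m x y z.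

(** A rotor acts on the complexified plane with eigenvalues [z] and [1 / z], so
    on a triple tensor product with odd powers of [z], none of which is 1. In
    coordinates this says that the eight linear equations of invariance have
    only the zero solution. *)
Lemma trilinear_plane i j x y z : i != j ->
  x \in [:: i; j] -> y \in [:: i; j] -> z \in [:: i; j] ->
  m (basis_vec R x) (basis_vec R y) (basis_vec R z) = 0.
Proof.
move=> ij xij yij zij; have [a [b [ab e1 _ s1 _]]] := rotor_pair ij.
have inv := mg s1.
have gi := rotor_rep_i cl ij e1; have gj := rotor_rep_j cl ij e1.
rewrite -scaleNr in gi.
have h1 := inv (basis_vec R i) (basis_vec R i) (basis_vec R i).
have h2 := inv (basis_vec R i) (basis_vec R i) (basis_vec R j).
have h3 := inv (basis_vec R i) (basis_vec R j) (basis_vec R i).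
have h4 := inv (basis_vec R i) (basis_vec R j) (basis_vec R j).
have h5 := inv (basis_vec R j) (basis_vec R i) (basis_vec R i).
have h6 := inv (basis_vec R j) (basis_vec R i) (basis_vec R j).
have h7 := inv (basis_vec R j) (basis_vec R j) (basis_vec R i).
have h8 := inv (basis_vec R j) (basis_vec R j) (basis_vec R j).
rewrite ?gi ?gj !m1 !m2 !m3 in h1 h2 h3 h4 h5 h6 h7 h8.
clear inv gi gj m1 m2 m3 mg e1 s1.
have sij : bivector_sign R i j = - (gen_sign R i * gen_sign R j) by [].
have si := gen_sign_cases R i.
have sj := gen_sign_cases R j.
move: h1 h2 h3 h4 h5 h6 h7 h8.
have mem2 k : k \in [:: i; j] -> k = i \/ k = j.
  by rewrite !inE => /orP[] /eqP ->; [left|right].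
move: (mem2 _ xij) (mem2 _ yij) (mem2 _ zij).
by case: si sij => ->; case: sj => -> sij; rewrite ?mulr1 ?mulrN1 ?opprK in sij;
  case: ab => -[e1 -> ->]; rewrite e1 in sij *; try (exfalso; lra);
  move=> [->|->] [->|->] [->|->]; lra.
Qed.

End Trilinear.
End Rotors.

Section Trilinear.
Variable R : realType.
Variables (r s : nat) (C : falgType R) (iota : 'Hom('rV[R]_(r + s), C)).
Hypothesis cl : is_clifford_map iota.
Local Notation V := 'rV[R]_(r + s).
Variable m : V -> V -> V -> R.
Hypothesis m1 : forall a b x x' y z, m (a *: x + b *: x') y z = a * m x y z + b * m x' y z.
Hypothesis m2 : forall a b x y y' z, m x (a *: y + b *: y') z = a * m x y z + b * m x y' z.
Hypothesis m3 : forall a b x y z z', m x y (a *: z + b *: z') = a * m x y z + b * m x y z'.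
Hypothesis mg : forall g, spin0 iota g -> forall x y z,
  m (vector_rep iota g x) (vector_rep iota g y) (vector_rep iota g z) = m x y z.

(** A rotor in the plane of [e_i] and [e_l] moves only the first argument, and
    it fixes no nonzero linear form on that plane. *)
Lemma trilinear_distinct i j k l : uniq [:: i; j; k; l] ->
  m (basis_vec R i) (basis_vec R j) (basis_vec R k) = 0.
Proof.
rewrite /= !inE !negb_or => /and4P[/and3P[ij ik il] /andP[jk jl] kl _].
have [a [b [ab e1 e2 s1 s2]]] := rotor_pair cl il.
have h1 := mg s1 (basis_vec R i) (basis_vec R j) (basis_vec R k).
have h2 := mg s2 (basis_vec R i) (basis_vec R j) (basis_vec R k).
rewrite rotor_rep_i // -scaleNr !rotor_rep_k // 1?eq_sym // m1 in h1.
rewrite rotor_rep_i // -scaleNr !rotor_rep_k // 1?eq_sym // m1 in h2.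
have si := gen_sign_cases R i.
by case: si h1 h2 => ->; case: ab => -[-> -> ->] h1 h2; lra.
Qed.

(** Three basis vectors lie in a coordinate plane, or are distinct; in the latter
    case there is a fourth one, as [n] is not 3. *)
Lemma trilinear_basis_vec : (1 < r + s)%N -> (r + s != 3)%N ->
  forall i j k, m (basis_vec R i) (basis_vec R j) (basis_vec R k) = 0.
Proof.
move=> n1 n3 i j k.
have plane x y : x != y -> i \in [:: x; y] -> j \in [:: x; y] -> k \in [:: x; y] ->
    m (basis_vec R i) (basis_vec R j) (basis_vec R k) = 0.
  by move=> xy; apply: (trilinear_plane cl m1 m2 m3 mg xy).
have other (l : seq 'I_(r + s)) : (size l < r + s)%N -> exists x, x \notin l.
  move=> sl; apply/existsP; rewrite -negb_forall; apply: contraL sl => /forallP h.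
  rewrite -leqNgt -[leqLHS]size_enum_ord; apply: uniq_leq_size (enum_uniq _) _ => x _.
  exact: h.
have [ij|ij] := eqVneq i j.
  have [ik|ik] := eqVneq i k.
    have [x] := other [:: i] n1; rewrite inE => xi.
    by apply: (plane x i xi); rewrite -?ij -?ik !inE eqxx orbT.
  by apply: (plane i k ik); rewrite -?ij !inE eqxx ?orbT.
have [ik|ik] := eqVneq i k; first by apply: (plane i j ij); rewrite -?ik !inE eqxx ?orbT.
have [jk|jk] := eqVneq j k; first by apply: (plane i j ij); rewrite -?jk !inE eqxx ?orbT.
(* [i], [j] and [k] are distinct, so [n] is at least 3, and it is not 3. *)
have n4 : (3 < r + s)%N.
  have : uniq [:: i; j; k] by rewrite /= !inE negb_or ij ik jk.
  move/card_uniqP => /= u; have := max_card (mem [:: i; j; k]); rewrite u card_ord.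
  by rewrite leq_eqVlt eq_sym (negPf n3).
have [x] := other [:: i; j; k] n4; rewrite !inE !negb_or => /and3P[xi xj xk].
by apply: (@trilinear_distinct i j k x); rewrite /= !inE !negb_or ij ik jk !(eq_sym _ x) xi xj xk.
Qed.

Lemma trilinear_zero : (1 < r + s)%N -> (r + s != 3)%N -> forall x y z, m x y z = 0.
Proof.
move=> n1 n3.
have m10 y z : m 0 y z = 0.
  by have := m1 0 0 0 0 y z; rewrite !scale0r addr0 !mul0r addr0.
have m20 x z : m x 0 z = 0.
  by have := m2 0 0 x 0 0 z; rewrite !scale0r addr0 !mul0r addr0.
have m30 x y : m x y 0 = 0.
  by have := m3 0 0 x y 0 0; rewrite !scale0r addr0 !mul0r addr0.
have ind (f : V -> R) : f 0 = 0 ->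
    (forall a b x y, f (a *: x + b *: y) = a * f x + b * f y) ->
    (forall i, f (basis_vec R i) = 0) -> forall x, f x = 0.
  move=> f0 fl fe x; rewrite (row_sum_basis_vec x); elim/big_ind: _ => // [u v fu fv|i _].
    by rewrite -[u]scale1r -[v]scale1r fl fu fv !mulr0 addr0.
  by rewrite -[_ *: _]addr0 -[X in _ + X](scale0r 0) fl fe mulr0 mul0r addr0.
move=> x y z; apply: (ind (fun x => m x y z)) => // i.
apply: (ind (fun y => m (basis_vec R i) y z)) => // j.
apply: (ind (fun z => m (basis_vec R i) (basis_vec R j) z)) => // k.
exact: trilinear_basis_vec.
Qed.

End Trilinear.

(** * Equivariant maps from vectors to operators *)

Section Equivariant.
Variable R : realType.
Variables (r s : nat) (C : falgType R) (iota : 'Hom('rV[R]_(r + s), C)).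
Hypothesis cl : is_clifford_map iota.
Local Notation V := 'rV[R]_(r + s).
Variables (S : vectType R) (rho : 'Hom(C, 'End(S))).
Hypothesis mod : is_module rho.
Local Notation E i := (gamma iota rho (basis_vec R i)).
Variable phi : V -> 'M[R]_(dim S).
Hypothesis phil : linear phi.
Hypothesis phig : forall g, spin0 iota g -> forall v,
  phi v *m rho_mx rho g = rho_mx rho g *m phi (vector_rep iota g v).

Lemma rho_mx_rotor i j a b :
  rho_mx rho (rotor iota i j a b) = a%:M + b *: (E j *m E i).
Proof. by rewrite /rotor linearD !linearZ /= (rho_mx1 mod) (rho_mxM mod) scalemx1. Qed.

Lemma gamma_basis_sqr i : E i *m E i = (gen_sign R i)%:M.
Proof. by rewrite (gamma_sqr cl mod) sprod_basis_vec eqxx opprK. Qed.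

Lemma gamma_basis_anticomm i j : i != j -> E i *m E j = - (E j *m E i).
Proof. by case: (gamma_clifford_system cl mod) => _ h _ ij; apply: h; rewrite ?mem_enum. Qed.

(** With [X = phi e_i], [Y = phi e_j] and [U] the action of [e_i e_j],
    equivariance under the rotors with parameters [b] and [- b] gives two
    linear relations between [X], [X U], [U X], [Y] and [U Y]. Their even and
    odd parts in [b] can be solved for [Y] and [X U]. *)
Lemma phi_anticomm i j : i != j ->
  phi (basis_vec R i) *m (E j *m E i) = - (E j *m E i *m phi (basis_vec R i)) /\
  phi (basis_vec R j) = gen_sign R i *: (E j *m E i *m phi (basis_vec R i)).
Proof.
move=> ij; have [a [b [ab e1 e2 s1 s2]]] := rotor_pair cl ij.
pose F : {linear V -> 'M[R]_(dim S)} := HB.pack phi (GRing.isLinear.Build _ _ _ _ phi phil).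
have phiB x y p q : phi (x *: p - y *: q) = x *: phi p - y *: phi q.
  by rewrite -[phi]/(F : V -> _) linearB !linearZ.
have h1 := phig s1 (basis_vec R i); have h2 := phig s2 (basis_vec R i).
rewrite rotor_rep_i // rho_mx_rotor phiB in h1; rewrite rotor_rep_i // rho_mx_rotor phiB in h2.
set U := E j *m E i in h1 h2 *; set X := phi (basis_vec R i) in h1 h2 *.
set Y := phi (basis_vec R j) in h1 h2 *.
have UU : U *m U = (bivector_sign R i j)%:M.
  rewrite /U mulmxA -[_ *m E i *m E j]mulmxA gamma_basis_anticomm // mulmxN mulNmx mulmxA gamma_basis_sqr.
  by rewrite mul_scalar_mx -scalemxAl gamma_basis_sqr scale_scalar_mx -raddfN /= mulrC.
rewrite !mulmxDr !mulmxDl mul_mx_scalar !mul_scalar_mx -!scalemxAr -!scalemxAl in h1 h2.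
rewrite !mulmxN -!scalemxAr in h1 h2.
have si := gen_sign_sqr R i.
(* The relations are solved entry by entry for the two numerical rotors; [ux]
   and the other variables stand for the products of matrices. *)
have sol (x xu ux y uy : 'M[R]_(dim S)) :
    a *: x + b *: xu = a *: ((a ^+ 2 + bivector_sign R i j * b ^+ 2) *: x) +
      (a ^+ 2 + bivector_sign R i j * b ^+ 2) *: (b *: ux) +
      (a *: - ((2 * (a * b) * gen_sign R i) *: y) +
       b *: - ((2 * (a * b) * gen_sign R i) *: uy)) ->
    a *: x + - b *: xu = a *: ((a ^+ 2 + bivector_sign R i j * (- b) ^+ 2) *: x) +
      (a ^+ 2 + bivector_sign R i j * (- b) ^+ 2) *: (- b *: ux) +
      (a *: - ((2 * (a * - b) * gen_sign R i) *: y) +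
       - b *: - ((2 * (a * - b) * gen_sign R i) *: uy)) ->
    bivector_sign R i j *: x = gen_sign R i *: uy /\ (y = gen_sign R i *: ux -> xu = - ux).
  clear h1 h2 UU e1 e2; move=> k1 k2.
  have s1i := gen_sign_cases R i.
  split=> [|yE]; apply/matrixP => p q.
    have := congr1 (fun M : 'M[R]_(dim S) => M p q)  k1.
    have := congr1 (fun M : 'M[R]_(dim S) => M p q) k2.
    by rewrite !mxE; case: s1i => ->; case: ab => -[-> -> ->]; lra.
  have := congr1 (fun M : 'M[R]_(dim S) => M p q) k1.
  have := congr1 (fun M : 'M[R]_(dim S) => M p q) k2.
  have := congr1 (fun M : 'M[R]_(dim S) => M p q) yE.
  by rewrite !mxE; case: s1i => ->; case: ab => -[-> -> ->]; lra.
have [eX sY] := sol _ _ _ _ _ h1 h2.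
have e0 : bivector_sign R i j != 0 by case: ab => -[-> _ _]; apply/eqP; lra.
have YE : Y = gen_sign R i *: (U *m X).
  have := congr1 (mulmx U) eX; rewrite -!scalemxAr mulmxA UU mul_scalar_mx => eUX.
  by apply: (scalerI e0); rewrite scalerA mulrC -scalerA eUX !scalerA mulrA si mul1r.
by split=> //; apply: sY.
Qed.

(** Since [e_o] and [phi e_o] both anticommute with [e_k e_o] for [k != o], their
    product [T] commutes with [e_k e_o], and these elements generate the even
    products. *)
Lemma equivariant_clifford : (1 < r + s)%N -> exists T : 'M[R]_(dim S),
  (forall i j, T *m (E i *m E j) = E i *m E j *m T) /\
  forall v, phi v = T *m gamma iota rho v.
Proof.
move=> n1; pose o : 'I_(r + s) := Ordinal (ltnW n1).
pose T := gen_sign R o *: (phi (basis_vec R o) *m E o).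
have TE i : phi (basis_vec R i) = T *m E i.
  have [->|io] := eqVneq i o.
    by rewrite -scalemxAl -mulmxA gamma_basis_sqr mul_mx_scalar scalerA gen_sign_sqr scale1r.
  rewrite eq_sym in io; have [h ->] := phi_anticomm io.
  rewrite -scalemxAl; congr (_ *: _).
  by rewrite -[RHS]mulmxA (gamma_basis_anticomm io) mulmxN h opprK.
have comO k : T *m (E k *m E o) = E k *m E o *m T.
  have [->|ko] := eqVneq k o; first by rewrite gamma_basis_sqr mul_mx_scalar mul_scalar_mx.
  rewrite eq_sym in ko; have [h _] := phi_anticomm ko.
  rewrite -scalemxAl -scalemxAr; congr (_ *: _).
  have -> : phi (basis_vec R o) *m E o *m (E k *m E o) =
      - (phi (basis_vec R o) *m (E k *m E o) *m E o).
    by rewrite -!mulmxA -mulmxN; congr (_ *m _); rewrite !mulmxA gamma_basis_anticomm // mulNmx.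
  by rewrite h mulNmx opprK mulmxA.
have comO' k : T *m (E o *m E k) = E o *m E k *m T.
  have [->|ko] := eqVneq k o; first exact: comO.
  by rewrite gamma_basis_anticomm 1?eq_sym // mulmxN mulNmx comO.
have com i j : T *m (E i *m E j) = E i *m E j *m T.
  have -> : E i *m E j = gen_sign R o *: ((E i *m E o) *m (E o *m E j)).
    rewrite -[E i *m E o *m _]mulmxA [E o *m (E o *m _)]mulmxA gamma_basis_sqr mul_scalar_mx.
    by rewrite -scalemxAr scalerA gen_sign_sqr scale1r.
  rewrite -[LHS]scalemxAr -[RHS]scalemxAl; congr (_ *: _).
  by rewrite [LHS]mulmxA comO -[LHS]mulmxA comO' [LHS]mulmxA.
exists T; split=> // v.
pose F : {linear V -> 'M[R]_(dim S)} :=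
  HB.pack phi (GRing.isLinear.Build _ _ _ _ phi phil).
rewrite gamma_sum mulmx_sumr -[phi v]/(F v) {1}(row_sum_basis_vec v) linear_sum.
by apply: eq_bigr => i _; rewrite linearZ /= TE scalemxAr.
Qed.

End Equivariant.

(** * Nomizu maps built from three operators *)

Section Forms.
Variables (R : realType) (S : vectType R).

Lemma mx_ext (M N : 'M[R]_(dim S)) :
  (forall x : S, v2r x *m M = v2r x *m N) -> M = N.
Proof.
by move=> h; apply/row_matrixP => i; rewrite !rowE -[delta_mx 0 i]r2vK h.
Qed.

Definition mxform (M : 'M[R]_(dim S)) (x y : S) : R :=
  (v2r x *m M *m (v2r y)^T) 0 0.

Lemma mxform_linl M a x x' y :
  mxform M (a *: x + x') y = a * mxform M x y + mxform M x' y.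
Proof. by rewrite /mxform linearP !mulmxDl -!scalemxAl mxE [X in X + _]mxE. Qed.

Lemma mxform_linr M a x y y' :
  mxform M x (a *: y + y') = a * mxform M x y + mxform M x y'.
Proof.
by rewrite /mxform !linearP /= mxE [X in X + _]mxE.
Qed.

Lemma mxform_linM M N a x y :
  mxform (a *: M + N) x y = a * mxform M x y + mxform N x y.
Proof.
by rewrite /mxform mulmxDr mulmxDl -scalemxAr -scalemxAl mxE [X in X + _]mxE.
Qed.

Lemma mxform_ext M N : (forall x y, mxform M x y = mxform N x y) -> M = N.
Proof.
have fE P i j : mxform P (r2v (delta_mx 0 i)) (r2v (delta_mx 0 j)) = P i j.
  by rewrite /mxform !r2vK trmx_delta -rowE -colE !mxE.
by move=> h; apply/matrixP => i j; rewrite -!fE h.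
Qed.

Definition form_mx (b : S -> S -> R) : 'M[R]_(dim S) :=
  \matrix_(i, j) b (r2v (delta_mx 0 i)) (r2v (delta_mx 0 j)).

Lemma form_mxE b : (forall y, scalar (b^~ y)) -> (forall x, scalar (b x)) ->
  forall x y, mxform (form_mx b) x y = b x y.
Proof.
move=> b1 b2.
have ex (f : S -> R) : scalar f ->
    forall x, f x = \sum_i v2r x 0 i * f (r2v (delta_mx 0 i)).
  move=> fl x; pose F : {linear S -> R | *%R} := HB.pack f (GRing.isLinear.Build _ _ _ _ f fl).
  rewrite -{1}[x]v2rK {1}(row_sum_delta (v2r x)) linear_sum -[f]/(F : S -> R) linear_sum.
  by apply: eq_bigr => i _; rewrite !linearZ.
move=> x y; rewrite (ex (b^~ y)) // /mxform mxE.
under [RHS]eq_bigr => i _ do rewrite (ex (b _)) // mulr_sumr.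
rewrite exchange_big; apply: eq_bigr => j _ /=.
by rewrite !mxE mulr_suml; apply: eq_bigr => i _; rewrite !mxE mulrA mulrAC.
Qed.

End Forms.

Section Nomizu.
Variable R : realType.
Variables (r s : nat) (C : falgType R) (iota : 'Hom('rV[R]_(r + s), C)).
Hypothesis cl : is_clifford_map iota.
Local Notation V := 'rV[R]_(r + s).
Variables (S : vectType R) (rho : 'Hom(C, 'End(S))).
Hypothesis mod : is_module rho.
Local Notation E := (gamma iota rho).
Local Notation M := 'M[R]_(dim S).
Variables (H : M) (c : R).
Hypotheses (uH : H \in unitmx) (cc : c * c = 1).
Hypothesis HE : forall i, E (basis_vec R i) *m H = c *: (H *m (E (basis_vec R i))^T).
Hypothesis d0 : (0 < dim S)%N.

Lemma sprodDl a (x y v : V) : sprod (a *: x + y) v = a * sprod x v + sprod y v.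
Proof. by rewrite !(sprodC _ v) linearP. Qed.

Lemma sprodZDl a b (x y v : V) :
  sprod (a *: x + b *: y) v = a * sprod x v + b * sprod y v.
Proof. by rewrite !(sprodC _ v) linearD !linearZ. Qed.

(** The vector that represents the linear form
    [v |-> beta (gamma v (T x), y)] on [V], where [beta] is the form [H]; see
    [sprod_bracket]. *)
Definition bracket (T : M) (x y : S) : V :=
  \row_i (- gen_sign R i * mxform (T *m E (basis_vec R i) *m H) x y).

Lemma sprod_bracket T x y v : sprod (bracket T x y) v = mxform (T *m E v *m H) x y.
Proof.
rewrite gamma_sum mulmx_sumr mulmx_suml /mxform mulmx_sumr mulmx_suml summxE.
apply: eq_bigr => i _; rewrite mxE -!scalemxAr -!scalemxAl -scalemxAr -scalemxAl mxE.
rewrite (_ : (if _ then _ else _) = - gen_sign R i); last by rewrite /gen_sign; case: ifP; rewrite ?opprK.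
by rewrite mulrA mulrNN gen_sign_sqr mul1r mulrC.
Qed.

(** The components of [T] give the pieces [V x S -> S], [S x V -> S] and
    [S x S -> V] of a Nomizu map. *)
Definition nomizu_fun (T : M * M * M) (p p' : V * S) : V * S :=
  (bracket T.2 p.2 p'.2,
   r2v (v2r p'.2 *m T.1.1 *m E p.1 + v2r p.2 *m T.1.2 *m E p'.1)).

Lemma pairP (p p' : V * S) : (forall v, sprod p.1 v = sprod p'.1 v) ->
  v2r p.2 = v2r p'.2 -> p = p'.
Proof. by case: p p' => [? ?] [? ?] /= /sprod_inj -> /v2r_inj ->. Qed.

Lemma nomizu_fun_linr T p : linear (nomizu_fun T p).
Proof.
move=> a p1 p2; apply: pairP => [v|] /=.
  rewrite sprodDl !sprod_bracket.
  exact: mxform_linr.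
rewrite r2vK [RHS]linearP /= !r2vK [v2r (_ + _)]linearP [E (_ + _)]linearP /=.
by rewrite !mulmxDl -!scalemxAl mulmxDr -scalemxAr scalerDr addrACA.
Qed.

Lemma nomizu_fun_linl T p' : linear (fun p => nomizu_fun T p p').
Proof.
move=> a p1 p2; apply: pairP => [v|] /=.
  rewrite sprodDl !sprod_bracket.
  exact: mxform_linl.
rewrite r2vK [RHS]linearP /= !r2vK [v2r (_ + _)]linearP [E (_ + _)]linearP /=.
by rewrite !mulmxDl -!scalemxAl mulmxDr -scalemxAr scalerDr addrACA.
Qed.

Lemma nomizu_fun_linT p p' : linear (fun T => nomizu_fun T p p').
Proof.
move=> a p1 p2; apply: pairP => [v|] /=.
  rewrite sprodDl !sprod_bracket !mulmxDl -!scalemxAl.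
  exact: mxform_linM.
rewrite r2vK [RHS]linearP /= !r2vK !mulmxDr !mulmxDl -!scalemxAr -!scalemxAl.
by rewrite scalerDr addrACA.
Qed.

Definition nomizu_of (T : M * M * M) : 'Hom((V * S)%type, 'End((V * S)%type)) :=
  linfun (fun p => linfun (nomizu_fun T p)).

Lemma nomizu_ofE T p p' : nomizu_of T p p' = nomizu_fun T p p'.
Proof.
rewrite /nomizu_of linfun_linear; first by rewrite linfun_linear //; apply: nomizu_fun_linr.
move=> a p1 p2; apply/lfunP => q.
rewrite add_lfunE scale_lfunE !linfun_linear; try exact: nomizu_fun_linr.
exact: nomizu_fun_linl.
Qed.

Lemma nomizu_of_linear : linear nomizu_of.
Proof.
move=> a T T'; apply/lfunP => p; apply/lfunP => p'.
by rewrite !add_lfunE !scale_lfunE !nomizu_ofE nomizu_fun_linT.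
Qed.

Lemma nomizu_of_inj T : (0 < r + s)%N -> nomizu_of T = 0 -> T = 0.
Proof.
move=> n0 T0; pose o : 'I_(r + s) := Ordinal n0.
have h p p' : nomizu_fun T p p' = 0 by rewrite -nomizu_ofE T0 !zero_lfunE.
have gamma0 (N : M) : N *m E (basis_vec R o) = 0 -> N = 0.
  move=> N0; have := congr1 (mulmx^~ (E (basis_vec R o))) N0; rewrite /= -mulmxA mul0mx.
  rewrite (gamma_sqr cl mod) sprod_basis_vec eqxx opprK mul_mx_scalar => /eqP.
  by rewrite scaler_eq0 (negPf (gen_sign_neq0 R o)) => /eqP.
have e1 : T.1.1 = 0.
  apply: gamma0; apply: mx_ext => x; rewrite mulmx0 mulmxA.
  have := congr1 (fun p => v2r p.2) (h (basis_vec R o, 0) (0, x)).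
  by rewrite /= r2vK !linear0 ?mul0mx ?mulmx0 addr0.
have e2 : T.1.2 = 0.
  apply: gamma0; apply: mx_ext => x; rewrite mulmx0 mulmxA.
  have := congr1 (fun p => v2r p.2) (h (0, x) (basis_vec R o, 0)).
  by rewrite /= r2vK !linear0 ?mul0mx ?mulmx0 add0r.
have e3 : T.2 = 0.
  apply: gamma0; apply: (can_inj (mulmxK uH)); apply: mxform_ext => x y.
  have b0 : bracket T.2 x y = 0 := congr1 fst (h (0, x) (0, y)).
  by rewrite -sprod_bracket b0 sprodC linear0 mul0mx /mxform mulmx0 mul0mx mxE.
by move: e1 e2 e3; case: (T) => [[? ?] ?] /= -> -> ->.
Qed.

End Nomizu.

(** * All Nomizu maps arise in this way *)

Section Equivariance.
Variable R : realType.
Variables (r s : nat) (C : falgType R) (iota : 'Hom('rV[R]_(r + s), C)).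
Hypothesis cl : is_clifford_map iota.
Local Notation V := 'rV[R]_(r + s).
Variables (S : vectType R) (rho : 'Hom(C, 'End(S))).
Hypothesis mod : is_module rho.
Local Notation E := (gamma iota rho).
Local Notation rho_mx := (rho_mx rho).
Local Notation M := 'M[R]_(dim S).
Local Notation iso := (isotropy_rep iota rho).
Variables (H : M) (c : R).
Hypotheses (uH : H \in unitmx) (cc : c * c = 1).
Hypothesis HE : forall i, E (basis_vec R i) *m H = c *: (H *m (E (basis_vec R i))^T).
Hypothesis d0 : (0 < dim S)%N.

Lemma spin0_group g : spin0 iota g -> spin_group iota g.
Proof. by case. Qed.

Lemma isotropyK g : spin_group iota g -> cancel (iso g) (iso g^-1).
Proof.
move=> sg [v x]; rewrite /isotropy_rep /= (vector_repK cl sg).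
by rewrite -comp_lfunE -mod.2 mulVr ?(spin_group_unit cl sg) // mod.1 id_lfunE.
Qed.

Lemma isotropyVK g : spin_group iota g -> cancel (iso g^-1) (iso g).
Proof. by move=> /(spin_groupV cl)/isotropyK h x; have := h x; rewrite invrK. Qed.

Lemma gamma_vector_rep g v : spin_group iota g ->
  rho_mx g *m E (vector_rep iota g v) = E v *m rho_mx g.
Proof.
move=> sg; rewrite /gamma -!(rho_mxM mod) iota_vector_rep //.
by rewrite mulrVK // (spin_group_unit cl sg).
Qed.

Definition even_commuting (T : M) :=
  forall i j, T *m (E (basis_vec R i) *m E (basis_vec R j)) = E (basis_vec R i) *m E (basis_vec R j) *m T.

Lemma even_commutingE T v w : even_commuting T ->
  T *m (E v *m E w) = E v *m E w *m T.
Proof.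
move=> cT; rewrite (gamma_sum _ _ v) (gamma_sum _ _ w) !mulmx_suml mulmx_sumr.
apply: eq_bigr => i _; rewrite !mulmx_sumr mulmx_suml; apply: eq_bigr => j _.
rewrite -scalemxAl -[E (basis_vec R i) *m _]scalemxAr scalerA.
by rewrite -[LHS]scalemxAr -[RHS]scalemxAl cT.
Qed.

Lemma even_commuting_spin T g : even_commuting T -> spin_group iota g ->
  T *m rho_mx g = rho_mx g *m T.
Proof.
move=> cT [vs [evs _ ->]]; have [n] := ubnP (size vs).
elim: n vs evs => // n IH [|v [|w vs]] //= evs szn.
  by rewrite big_nil (rho_mx1 mod) mulmx1 mul1mx.
rewrite negbK in evs; have {}IH := IH vs evs (ltnW szn).
rewrite !big_cons mulrA (rho_mxM mod) mulmxA IH -!mulmxA (rho_mxM mod).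
by rewrite even_commutingE // -!mulmxA.
Qed.

(** [T] commutes with [g], [g] conjugates [gamma v] to [gamma (g v)], and [g]
    preserves the form [H]. *)
Lemma nomizu_fun_equivariant T g p p' : spin0 iota g ->
  even_commuting T.1.1 -> even_commuting T.1.2 -> even_commuting T.2 ->
  nomizu_fun iota rho H T (iso g p) (iso g p') = iso g (nomizu_fun iota rho H T p p').
Proof.
move=> sg0 c1 c2 c3; have sg := spin0_group sg0; have sgV := spin_groupV cl sg.
have EE v : rho_mx g *m E (vector_rep iota g v) = E v *m rho_mx g by apply: gamma_vector_rep.
have com T' : even_commuting T' -> rho_mx g *m T' = T' *m rho_mx g.
  by move=> cT; rewrite even_commuting_spin.
apply: pairP => [v|] /=.
  rewrite -[v](vector_repK cl sgV) invrK; set w := vector_rep iota g^-1 v.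
  rewrite (sprod_vector_rep cl) // !sprod_bracket /mxform !v2r_rho trmx_mul.
  rewrite -!mulmxA; congr ((_ *m _) 0 0).
  rewrite [rho_mx g *m (T.2 *m _)]mulmxA com // -!mulmxA; congr (_ *m _).
  rewrite [rho_mx g *m (E _ *m _)]mulmxA EE -!mulmxA; congr (_ *m _).
  rewrite !mulmxA; congr (_ *m _).
  exact: (form_spin0 cl mod uH cc HE d0 sg0).
rewrite r2vK !v2r_rho r2vK mulmxDl -!mulmxA; congr (_ + _).
  by rewrite [rho_mx g *m (T.1.1 *m _)]mulmxA com // -[_ *m rho_mx g *m _]mulmxA EE.
by rewrite [rho_mx g *m (T.1.2 *m _)]mulmxA com // -[_ *m rho_mx g *m _]mulmxA EE.
Qed.

Lemma bracket0l T (x : S) : bracket iota rho H T 0 x = 0.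
Proof. by apply/rowP => i; rewrite !mxE /mxform linear0 !mul0mx mxE mulr0. Qed.

Lemma bracket0r T (x : S) : bracket iota rho H T x 0 = 0.
Proof. by apply/rowP => i; rewrite !mxE /mxform !linear0 mxE mulr0. Qed.

Lemma nomizu_of_nomizu T :
  even_commuting T.1.1 -> even_commuting T.1.2 -> even_commuting T.2 ->
  nomizu_maps iota rho (nomizu_of iota rho H T).
Proof.
move=> c1 c2 c3; split=> [v|x|g sg x y].
- split=> y; rewrite nomizu_ofE /=; last exact: bracket0l.
  by rewrite !linear0 ?mul0mx addr0 linear0.
- split=> y; rewrite nomizu_ofE /=; first exact: bracket0r.
  by rewrite !linear0 ?mulmx0 addr0 linear0.
rewrite !nomizu_ofE -nomizu_fun_equivariant // isotropyVK //; exact: spin0_group.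
Qed.

(** Each piece of [L] is reduced to an equivariant map from [V] to the matrices;
    for the piece [S x S -> V] this map is obtained from the trilinear form
    [sprod (B x y) v] by dividing by the invertible form [H]. *)
Lemma nomizu_ofP L : (1 < r + s)%N -> (r + s != 3)%N -> nomizu_maps iota rho L ->
  exists T : M * M * M, [/\ even_commuting T.1.1, even_commuting T.1.2,
    even_commuting T.2 & L = nomizu_of iota rho H T].
Proof.
move=> n1 n3 [Lev Lodd Leq].
have {}Leq g p p' : spin0 iota g -> L (iso g p) (iso g p') = iso g (L p p').
  by move=> sg; rewrite Leq // isotropyK //; apply: spin0_group.
have vV g v : spin_group iota g -> iso g (v, 0) = (vector_rep iota g v, 0).
  by move=> _; rewrite /isotropy_rep /= linear0.
have vS g x : spin_group iota g -> iso g (0, x) = (0, rho g x).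
  move=> sg; rewrite /isotropy_rep /vector_rep /=.
  by rewrite !(linear0, mulr0, mul0r).
have splitE (p : V * S) : p = (p.1, 0) + (0, p.2).
  by case: p => v x; congr (_, _); rewrite /= ?addr0 ?add0r.
have inV a (v w : V) : ((a *: v + w, 0) : V * S) = a *: (v, 0) + (w, 0).
  by congr (_, _); rewrite /= ?scaler0 ?addr0.
have inS a (x y : S) : ((0, a *: x + y) : V * S) = a *: (0, x) + (0, y).
  by congr (_, _); rewrite /= ?scaler0 ?addr0.
pose M0 v w := (L (v, 0) (w, 0)).1.
pose A1 v y := (L (v, 0) (0, y)).2.
pose A2 w x := (L (0, x) (w, 0)).2.
pose B x y := (L (0, x) (0, y)).1.
have inV2 a b (v w : V) : ((a *: v + b *: w, 0) : V * S) = a *: (v, 0) + b *: (w, 0).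
  by congr (_, _); rewrite /= ?scaler0 ?addr0.
have M00 v w : M0 v w = 0.
  apply: sprod_inj => z; rewrite [RHS]sprodC linear0.
  apply: (trilinear_zero (m := fun v w z => sprod (M0 v w) z) cl _ _ _ _ n1 n3).
  - move=> a b x x' y t; rewrite /M0 inV2 [L _]linearD add_lfunE !linearZ.
    by rewrite !scale_lfunE; apply: sprodZDl.
  - move=> a b x y y' t; rewrite /M0 inV2 linearD !linearZ.
    exact: sprodZDl.
  - by move=> a b x y t t'; rewrite linearD !linearZ.
  - move=> g sg0 x y t; have sg := spin0_group sg0.
    rewrite -(sprod_vector_rep cl (M0 x y) _ sg); congr sprod.
    by rewrite /M0 -!vV // Leq.
have A1l v : linear (A1 v) by move=> a x y; rewrite /A1 inS linearP.
have A2l w : linear (A2 w).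
  by move=> a x y; rewrite /A2 inS linearP add_lfunE scale_lfunE.
pose f1 v : M := f2mx (linfun (A1 v)); pose f2 w : M := f2mx (linfun (A2 w)).
have f1E v y : v2r y *m f1 v = v2r (A1 v y) by rewrite -v2r_lfun linfun_linear.
have f2E v y : v2r y *m f2 v = v2r (A2 v y) by rewrite -v2r_lfun linfun_linear.
have f1l : linear f1.
  move=> a v w; apply: mx_ext => x; rewrite mulmxDr -scalemxAr !f1E -linearP.
  by congr v2r; rewrite /A1 inV linearP add_lfunE scale_lfunE.
have f2l : linear f2.
  move=> a v w; apply: mx_ext => x; rewrite mulmxDr -scalemxAr !f2E -linearP.
  by congr v2r; rewrite /A2 inV linearP.
have f1g g : spin0 iota g -> forall v, f1 v *m rho_mx g = rho_mx g *m f1 (vector_rep iota g v).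
  move=> sg0 v; have sg := spin0_group sg0; apply: mx_ext => x.
  rewrite !mulmxA f1E -!v2r_rho f1E; congr v2r.
  by rewrite /A1 -vV // -vS // Leq.
have f2g g : spin0 iota g -> forall v, f2 v *m rho_mx g = rho_mx g *m f2 (vector_rep iota g v).
  move=> sg0 v; have sg := spin0_group sg0; apply: mx_ext => x.
  rewrite !mulmxA f2E -!v2r_rho f2E; congr v2r.
  by rewrite /A2 -vV // -vS // Leq.
have [f3 f3H] : exists f3 : V -> M,
    forall v, f3 v *m H = form_mx (fun x y => sprod (B x y) v).
  exists (fun v => form_mx (fun x y => sprod (B x y) v) *m invmx H) => v.
  by rewrite mulmxKV.
have Bl x y v a x' : sprod (B (a *: x + x') y) v = a * sprod (B x y) v + sprod (B x' y) v.
  by rewrite -sprodDl /B inS linearP add_lfunE scale_lfunE.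
have Br x y v a y' : sprod (B x (a *: y + y')) v = a * sprod (B x y) v + sprod (B x y') v.
  by rewrite -sprodDl /B inS linearP.
have f3E v x y : mxform (f3 v *m H) x y = sprod (B x y) v.
  by rewrite f3H form_mxE // => [? ? ?|? ? ? ?]; rewrite ?Bl ?Br.
have f3l : linear f3.
  move=> a v w; apply: (can_inj (mulmxK uH)); apply: mxform_ext => x y.
  by rewrite mulmxDl -scalemxAl mxform_linM !f3E linearP.
have f3g g : spin0 iota g -> forall v, f3 v *m rho_mx g = rho_mx g *m f3 (vector_rep iota g v).
  move=> sg0 v; have sg := spin0_group sg0; have gu := spin_group_unit cl sg.
  have gH : rho_mx g *m H *m (rho_mx g)^T = H by exact: (form_spin0 cl mod uH cc HE d0 sg0).
  have gK : (rho_mx g)^T *m (rho_mx g^-1)^T = 1%:M.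
    by rewrite -trmx_mul -(rho_mxM mod) mulrV // (rho_mx1 mod) trmx1.
  apply: (can_inj (mulmxK uH)); rewrite /= -[LHS]mulmx1 -[RHS]mulmx1 -gK.
  rewrite !mulmxA; congr (_ *m _); rewrite -!mulmxA [rho_mx g *m (H *m _)]mulmxA gH.
  apply: mxform_ext => x y; rewrite f3E.
  transitivity (mxform (f3 (vector_rep iota g v) *m H) (rho g x) (rho g y)).
    rewrite f3E -(sprod_vector_rep cl _ _ sg); congr sprod.
    by rewrite /B -!vS // Leq.
  by rewrite /mxform !v2r_rho trmx_mul !mulmxA.
have [T1 [c1 T1E]] := equivariant_clifford cl mod f1l f1g n1.
have [T2 [c2 T2E]] := equivariant_clifford cl mod f2l f2g n1.
have [T3 [c3 T3E]] := equivariant_clifford cl mod f3l f3g n1.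
exists (T1, T2, T3); split=> //.
apply/lfunP => p; apply/lfunP => p'; rewrite nomizu_ofE.
have LE : L p p' = L (p.1, 0) (p'.1, 0) + L (p.1, 0) (0, p'.2) +
    (L (0, p.2) (p'.1, 0) + L (0, p.2) (0, p'.2)).
  by rewrite {1}(splitE p) {1}(splitE p') [L _]linearD add_lfunE !linearD.
have [e1 e2] := Lev p.1.
have [w1 w2] := Lodd p.2.
rewrite LE; apply: pairP => [v|] /=.
  rewrite -/(M0 _ _) M00 e2 w1 !add0r sprod_bracket /= -T3E f3E.
  by [].
rewrite e1 w2 add0r addr0 r2vK linearD /= -!mulmxA -T1E -T2E f1E f2E.
by [].
Qed.

End Equivariance.

Lemma connection_dim_residue (r s k a b : nat) : (k < 8)%N ->
  (r + 8 * a = s + k + 8 * b)%N ->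
  connection_dim (r%:Z - s%:Z) = (3 * nth 0 [:: 2; 4; 8; 4; 8; 4; 2; 1] k)%N.
Proof.
move=> k8 rs; rewrite /connection_dim.
have -> : (r%:Z - s%:Z = (b%:Z - a%:Z) * 8 + k%:Z)%R by lia.
rewrite modzMDl modz_small ?ltz_nat ?k8 //=.
by move: k k8 {rs}; do 8![case=> //].
Qed.

(** * The dimension *)

Theorem theorem0p2 (R : realType) (r s : nat)
    (C : falgType R) (iota : 'Hom('rV[R]_(r + s), C))
    (S : vectType R) (rho : 'Hom(C, 'End(S)))
    (Gamma : S -> S -> 'rV[R]_(r + s)) :
  (r + s != 0)%N -> (r + s != 1)%N -> (r + s != 3)%N ->
  is_clifford_algebra iota ->
  is_irreducible_module rho ->
  is_poincare_bracket iota rho Gamma ->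
  has_dim (nomizu_maps iota rho) (connection_dim (r%:Z - s%:Z)).
Proof.
move=> n0 n1 n3 clU irrU _.
have cl := clU.1; have [mod _ _] := irrU.
have n_gt1 : (1 < r + s)%N by case: (r + s)%N n0 n1 {n3} => [|[|]].
have n_gt0 := ltnW n_gt1.
have d0 := module_dim_gt0 irrU.
have cA := gamma_clifford_system cl mod; have irr := gamma_irreducible clU irrU.
have [K [KE [k [a [b [k8 rs dK]]]]]] := dim_even_commutant d0 cA irr n_gt0.
have [H [c [uH cc HE]]] := spin_form cA.
pose T3 := (subvs_of K * subvs_of K * subvs_of K)%type.
pose incl (t : T3) : 'M[R]_(dim S) * 'M[R]_(dim S) * 'M[R]_(dim S) :=
  (vsval t.1.1, vsval t.1.2, vsval t.2).
pose Psi (t : T3) := nomizu_of iota rho H (incl t).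
have Psil : linear Psi.
  by move=> x t t'; rewrite /Psi -nomizu_of_linear.
have mem (t : subvs_of K) : even_commuting iota rho (vsval t).
  by apply/KE; apply: subvsP.
exists (limg (linfun Psi)); split=> [L|].
  split=> [/memv_imgP[t _ ->]|].
    by rewrite linfun_linear //; apply: (nomizu_of_nomizu cl mod uH cc HE d0); apply: mem.
  move=> /(nomizu_ofP cl mod uH cc HE d0 n_gt1 n3)[[[T1 T2] T4] /= [c1 c2 c4 ->]].
  apply/memv_imgP; move/KE in c1; move/KE in c2; move/KE in c4.
  exists (Subvs c1, Subvs c2, Subvs c4); first exact: memvf.
  by rewrite linfun_linear.
rewrite limg_dim_eq; last first.
  apply/eqP; rewrite -subv0; apply/subvP => t; rewrite memv_cap memv_ker memv0.
  rewrite linfun_linear // => /andP[_ /eqP].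
  move=> /(nomizu_of_inj cl mod uH n_gt0); case: t => [[t1 t2] t4] t0.
  have e1 : t1 = 0 by apply: val_inj; apply: (congr1 (fun p => p.1.1) t0).
  have e2 : t2 = 0 by apply: val_inj; apply: (congr1 (fun p => p.1.2) t0).
  have e4 : t4 = 0 by apply: val_inj; apply: (congr1 (fun p => p.2) t0).
  by rewrite e1 e2 e4.
rewrite (connection_dim_residue k8 rs) -dK dimvf.
by have -> : dim T3 = (\dim K + \dim K + \dim K)%N by []; rewrite !mulSn addn0 addnA.
Qed.
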